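(* Assume $\mathrm{add}(\mathcal{N})=\mathrm{non}(\mathcal{M})$. Then there is a non-separable growth of $\omega$ which supports a measure, which has countable $\pi$-character, and which is scatteredly-fibered and linearly-fibered. In particular, this space does not map continuously onto $[0,1]^{\omega_1}$.
   Context: $\mathcal{N}$ is the $\sigma$-ideal of Lebesgue null sets and $\mathcal{M}$ is the $\sigma$-ideal of meager sets (of reals). For an ideal $\mathcal{I}$ of subsets of a set $X$: $\mathrm{add}(\mathcal{I})=\min\{|\mathcal{A}|: \mathcal{A}\subseteq\mathcal{I},\ \bigcup\mathcal{A}\notin\mathcal{I}\}$ and $\mathrm{non}(\mathcal{I})=\min\{|Y|: Y\subseteq X,\ Y\notin\mathcal{I}\}$. A compactification of $\omega$ (with the discrete topology) is a compact (Hausdorff) space $K\supseteq\omega$ in which $\omega$ is a dense (discrete) subspace; a growth of $\omega$ is a space of the form $K\setminus\omega$, where $K$ is a compactification of $\omega$. A compact space $K$ supports a measure if there is a (finite Radon) measure $\mu$ on $K$ with $\mu(U)>0$ for every nonempty open $U\subseteq K$. A space $K$ has countable $\pi$-character if each $x\in K$ has a countable local $\pi$-base, i.e. a countable family $\mathcal{U}_x$ of nonempty open sets such that each neighbourhood of $x$ contains an element of $\mathcal{U}_x$. A space $K$ is scatteredly-fibered if there is a continuous function $f\colon K\to M$ into a metric space $M$ such that each fiber $f^{-1}[x]$ is a scattered space; it is linearly-fibered if there is a continuous function $f\colon K\to M$ into a metric space $M$ such that each fiber $f^{-1}[x]$ is a linearly ordered topological space (i.e. its topology is the order topology of some linear order).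 *)

(* Defs.v *)
From HB Require Import structures.
From mathcomp Require Import all_boot all_order all_algebra.
From mathcomp Require Import all_classical all_reals all_analysis.
From mathcomp Require wochoice.
Import Order.TTheory GRing.Theory Num.Theory.
Import numFieldNormedType.Exports.

Set Implicit Arguments.
Unset Strict Implicit.
Unset Printing Implicit Defensive.

Local Open Scope classical_set_scope.
Local Open Scope card_scope.
Local Open Scope ring_scope.

(* Cardinals are represented by sets up to equipotence [#=]: [is_add I k] reads
   "add(I) = |k|" and [is_non I k] reads "non(I) = |k|". *)
Definition is_min_card {X U : Type} (F : set (set X)) (k : set U) : Prop :=
  (exists2 A, F A & A #= k) /\ (forall A, F A -> k #<= A).

Definition is_add {X U : Type} (I : set (set X)) (k : set U) : Prop :=
  is_min_card
    [set A : set (set X) | A `<=` I /\ ~ I (\bigcup_(B in A) B)] k.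

Definition is_non {X U : Type} (I : set (set X)) (k : set U) : Prop :=
  is_min_card [set Y : set X | ~ I Y] k.

Definition null_ideal (R : realType) : set (set R) :=
  (@lebesgue_measure R).-negligible.
Arguments null_ideal : clear implicits.

Definition nowhere_dense {T : topologicalType} (A : set T) : Prop :=
  interior (closure A) = set0.

Definition meager {T : topologicalType} (A : set T) : Prop :=
  exists2 F : nat -> set T,
    (forall n, nowhere_dense (F n)) & A = \bigcup_n F n.

Definition meager_ideal (R : realType) : set (set R) := @meager R.
Arguments meager_ideal : clear implicits.

Definition homeomorphic (X Y : topologicalType) : Prop :=
  exists (f : X -> Y) (g : Y -> X),
    [/\ cancel f g, cancel g f, continuous f & continuous g].

Definition separable (T : topologicalType) : Prop :=
  exists2 D : set T, countable D & dense D.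

Definition compactification_of_omega {K : topologicalType} (e : nat -> K) :
    Prop :=
  [/\ compact [set: K], hausdorff_space K, injective e,
      dense (range e) & range e `<=` isolated (range e)].

Definition growth_of_omega (G : topologicalType) : Prop :=
  exists (K : topologicalType) (e : nat -> K),
    compactification_of_omega e /\ homeomorphic G (set_type (~` range e)).

(* Measurable types are pointed, hence so is the space here. *)
Definition borel_type (T : ptopologicalType) := g_sigma_algebraType (@open T).

(* Inner regularity with respect to compact sets; the other requirement on a
   Radon measure, local finiteness, is automatic for a finite measure. *)
Definition radon (R : realType) (T : ptopologicalType)
    (mu : {finite_measure set (borel_type T) -> \bar R}) : Prop :=
  forall B : set (borel_type T), measurable B ->
    mu B = ereal_sup [set mu C | C in [set C : set T | compact C /\ C `<=` B]].

Definition supports_measure (R : realType) (T : ptopologicalType) : Prop :=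
  exists mu : {finite_measure set (borel_type T) -> \bar R},
    radon mu /\
    (forall U : set T, open U -> U !=set0 -> (0 < mu U)%E).

Definition local_pi_base {T : topologicalType} (x : T) (B : set (set T)) :
    Prop :=
  (forall V, B V -> open V /\ V !=set0) /\
  (forall N, nbhs x N -> exists2 V, B V & V `<=` N).

Definition countable_pi_character (T : topologicalType) : Prop :=
  forall x : T, exists2 B, countable B & local_pi_base x B.

Definition scattered (T : topologicalType) : Prop :=
  forall A : set T, A !=set0 -> isolated A !=set0.

Definition linearly_orderable (T : topologicalType) : Prop :=
  exists (d : Order.disp_t) (L : orderTopologicalType d), homeomorphic T L.

Definition fiber {K M : topologicalType} (f : K -> M) (y : M) :
    topologicalType :=
  set_type (f @^-1` [set y]).

Definition scatteredly_fibered (R : realType) (K : topologicalType) : Prop :=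
  exists (M : metricType R) (f : K -> M),
    continuous f /\ (forall y, scattered (fiber f y)).

Definition linearly_fibered (R : realType) (K : topologicalType) : Prop :=
  exists (M : metricType R) (f : K -> M),
    continuous f /\ (forall y, linearly_orderable (fiber f y)).

Definition is_omega1 (W : Type) (le : rel W) : Prop :=
  [/\ wochoice.well_order le, ~ countable [set: W] &
      forall x, countable [set y | le y x]].

Definition tychonoff_cube (R : realType) (W : Type) : topologicalType :=
  prod_topology (fun _ : W => set_type (`[0, 1]%classic : set R)).

Definition maps_continuously_onto (X Y : topologicalType) : Prop :=
  exists f : X -> Y, continuous f /\ (forall y, exists x, f x = y).

(* Main.v *)
(** Let [Z] be the product of the finite sets [{c < base i}]. A slalom [S] with
[\sum_i #|S i| / base i] finite is avoided, from some point on, by almost every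
[z] in [Z]. If [add(N) = non(M) = kappa], transfinite recursion gives slaloms
[S a] (a < kappa) that increase modulo finite sets and capture the digits of the
elements of a nonmeager set of reals, so that every [z], and even every sequence
of [z]'s, meets one [S a] infinitely often. That fewer than [kappa] summable slaloms
have a summable almost-upper bound is Bartoszynski's argument: the union of the null
sets [{z : z meets S infinitely often}] misses a set all of whose nonempty portions
have positive measure; the digits missing from a portion form a slalom, summable by
the product formula, and by a Baire category argument each given slalom is almost
contained in one of these countably many slaloms.

Consider the finite words [s] over the same digits and the subalgebra of P(words)
generated by the cylinders and the sets [{s extending t : s avoids S a beyond t}].
Its Stone space is a compactification of the countable set of words; the growth
consists of the pairs [(z, g)] such that [z] eventually avoids [S a] for all
[a < g]. The fiber over [z] is an initial segment of the well-order [kappa], so it is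
scattered and ordered, and the sets [{(z, g') : z extends t, a < g', z avoids S a
beyond t}] with [a] fixed form a countable local pi-base at every point [(z, a)].
Such a set is missed by all points whose [z] meets [S a] infinitely often, hence the
growth is not separable; it has positive Lebesgue measure, hence there is a strictly
positive measure. If the growth were mapped onto [0,1]^W, first a fiber and then an
ever smaller initial segment of a fiber would cover a cylinder of {0,1}^W with
countable support. *)

Require Import Defs.
From HB Require Import structures.
From mathcomp Require Import all_boot all_order all_algebra.
From mathcomp Require Import all_classical all_reals all_analysis.
From mathcomp Require Import ring lra zify.
From mathcomp Require wochoice.
From mathcomp Require Import finmap measurable_realfun.
Import Order.TTheory GRing.Theory Num.Theory.
Import numFieldNormedType.Exports.

Set Implicit Arguments.
Unset Strict Implicit.
Unset Printing Implicit Defensive.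

Local Open Scope classical_set_scope.
Local Open Scope ring_scope.

(** * Radon extension of a content on clopen sets *)

Lemma fset_nat_bounded (F : {fset nat}) :
  exists n, forall i, i \in F -> (i < n)%N.
Proof.
exists (\sum_(i <- F) i)%N.+1 => i iF; rewrite ltnS.
by rewrite (big_rem i)//= leq_addr.
Qed.

Section RadonExtension.
Local Open Scope ereal_scope.
Variables (R : realType) (T : ptopologicalType).
Variables (Cl : set (set T)) (m : set T -> \bar R).
Hypothesis cptT : compact [set: T].
Hypothesis Cl_clopen : forall C, Cl C -> clopen C.
Hypothesis Cl0 : Cl set0.
Hypothesis ClC : forall C, Cl C -> Cl (~` C).
Hypothesis ClU : forall C D, Cl C -> Cl D -> Cl (C `|` D).
Hypothesis Cl_base : forall U x, open U -> U x -> exists2 C, Cl C & C x /\ C `<=` U.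
Hypothesis m0 : m set0 = 0.
Hypothesis m_ge0 : forall C, Cl C -> 0 <= m C.
Hypothesis mD : forall C D, Cl C -> Cl D -> C `&` D = set0 -> m (C `|` D) = m C + m D.
Hypothesis mT_fin : m setT < +oo.

Let ClT : Cl setT. Proof. by rewrite -setC0; apply: ClC. Qed.

Let ClI C D : Cl C -> Cl D -> Cl (C `&` D).
Proof. by move=> cC cD; rewrite -[_ `&` _]setCK setCI; apply/ClC/ClU; apply: ClC. Qed.

Let ClD C D : Cl C -> Cl D -> Cl (C `\` D).
Proof. by move=> cC cD; rewrite setDE; apply: ClI => //; apply: ClC. Qed.

Let m_split C D : Cl C -> Cl D -> m C = m (C `&` D) + m (C `\` D).
Proof.
move=> cC cD; rewrite -mD; [|exact: ClI|exact: ClD|].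
  by rewrite setUIDK.
by rewrite setDE setIACA setICr setI0.
Qed.

Let le_m C D : Cl C -> Cl D -> C `<=` D -> m C <= m D.
Proof.
move=> cC cD CD; rewrite (m_split cD cC) (setIidr CD) leeDl//.
by apply: m_ge0; exact: ClD.
Qed.

Let m_fin C : Cl C -> m C \is a fin_num.
Proof.
move=> cC; rewrite ge0_fin_numE ?m_ge0//.
by apply: le_lt_trans mT_fin; apply: le_m.
Qed.

(** By compactness finitely many members of [Cl] inside [U] cover [K], and [Cl] is closed under
    finite unions. *)
Lemma clopen_interpolation (K U : set T) : closed K -> open U -> K `<=` U ->
  exists2 C, Cl C & K `<=` C /\ C `<=` U.
Proof.
move=> cK oU KU.
have : compact K by apply: (subclosed_compact cK cptT).
rewrite compact_cover => /(_ _ [set C | Cl C /\ C `<=` U] id)[].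
- by move=> C [/Cl_clopen[]].
- move=> x Kx; have [C cC [Cx CU]] := Cl_base oU (KU _ Kx).
  by exists C.
move=> F FU KF; exists (\bigcup_(C in [set` F]) C); last first.
  by split=> // x [C FC Cx]; have /set_mem[_] := FU _ FC; exact.
rewrite bigcup_fset big_seq; elim/big_ind : _ => //.
by move=> C FC; have /set_mem[] := FU _ FC.
Qed.

Let io (U : set T) := ereal_sup [set m C | C in [set C | Cl C /\ C `<=` U]].

Let m_io C U : Cl C -> C `<=` U -> m C <= io U.
Proof. by move=> cC CU; apply: ereal_sup_ubound; exists C. Qed.

Let io_ge0 U : 0 <= io U.
Proof. by rewrite -m0; apply: m_io. Qed.

Let le_io U V : U `<=` V -> io U <= io V.
Proof.
move=> UV; apply: ge_ereal_sup => _ [C [cC CU] <-].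
by apply: m_io => //; apply: subset_trans UV.
Qed.

Let io_lt U : io U < +oo.
Proof.
apply: le_lt_trans mT_fin; apply: ge_ereal_sup => _ [C [cC CU] <-].
exact: le_m.
Qed.

(** A member [E] of [Cl] between [C] minus [V] and [U] splits each [C] inside the union: the part in
    [E] lies in [U], the rest in [V]. *)
Let ioU U V : open U -> open V -> io (U `|` V) <= io U + io V.
Proof.
move=> oU oV; apply: ge_ereal_sup => _ [C [cC CUV] <-].
have clC : closed C by have [] := Cl_clopen cC.
have [|x [Cx nVx]|E cE [CE EU]] := @clopen_interpolation (C `\` V) U _ oU.
- by rewrite setDE; apply: closedI => //; exact: open_closedC.
- by have [] := CUV _ Cx.
rewrite (m_split cC cE); apply: leeD.
- by apply: m_io; [exact: ClI|move=> x [_ /EU]].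
- apply: m_io; first exact: ClD.
  by move=> x [Cx nEx]; apply: contrapT => nVx; apply: nEx; apply: CE.
Qed.

Let io0 : io set0 = 0.
Proof.
apply/eqP; rewrite eq_le io_ge0 andbT; apply: ge_ereal_sup => _ [C [cC C0] <-].
by have -> : C = set0; [apply/seteqP; split|rewrite m0].
Qed.

Let io_bigsetU (U : nat -> set T) n : (forall i, open (U i)) ->
  io (\bigcup_(i < n) U i) <= \sum_(i < n) io (U i).
Proof.
move=> oU; elim: n => [|n IH]; first by rewrite bigcup_mkord !big_ord0 io0.
rewrite bigcup_mkord !big_ord_recr/= -bigcup_mkord.
apply: le_trans (ioU _ _) _ => //; first exact: bigcup_open.
exact: leeD2r.
Qed.

Let io_bigcup (U : nat -> set T) : (forall i, open (U i)) ->
  io (\bigcup_i U i) <= \sum_(i <oo) io (U i).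
Proof.
move=> oU; apply: ge_ereal_sup => _ [C [cC CU] <-].
have clC : closed C by have [] := Cl_clopen cC.
have : compact C by apply: (subclosed_compact clC cptT).
rewrite compact_cover => /(_ _ setT U)[//|//|F _ CF].
have [n Fn] := fset_nat_bounded F.
have CFn : C `<=` \bigcup_(i < n) U i.
  by move=> x /CF[i /Fn ltin Ux]; exists i.
apply: le_trans (m_io cC CFn) _; apply: le_trans (io_bigsetU _ oU) _.
by rewrite -(big_mkord xpredT (fun i => io (U i))); apply: nneseries_lim_ge.
Qed.

(* [io] is inner approximation by sets of [Cl]; compactness makes it countably
   subadditive on open sets. *)
Definition clopen_outer (A : set T) :=
  ereal_inf [set io U | U in [set U | open U /\ A `<=` U]].
Local Notation om := clopen_outer.

Let om_open U : open U -> om U = io U.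
Proof.
move=> oU; apply/eqP; rewrite eq_le; apply/andP; split.
  by apply: ereal_inf_lbound; exists U => //; split.
by apply: le_ereal_inf_tmp => _ [V [_ UV] <-]; exact: le_io.
Qed.

Let om_le A U : open U -> A `<=` U -> om A <= io U.
Proof. by move=> oU AU; apply: ereal_inf_lbound; exists U. Qed.

Let le_om A B : A `<=` B -> om A <= om B.
Proof.
move=> AB; apply: le_ereal_inf_tmp => _ [V [oV BV] <-].
by apply: om_le => //; apply: subset_trans BV.
Qed.

Let om_ge0 A : 0 <= om A.
Proof. by apply: le_ereal_inf_tmp => _ [V [_ UV] <-]. Qed.

Let om_fin A : om A \is a fin_num.
Proof.
rewrite ge0_fin_numE//; apply: le_lt_trans (io_lt setT).
by apply: om_le => //; exact: openT.
Qed.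

Let om_approx A (e : R) : (0 < e)%R ->
  exists U, [/\ open U, A `<=` U & io U < om A + e%:E].
Proof.
move=> e0; have : om A < om A + e%:E by rewrite lteDl// lte_fin.
by move=> /ereal_inf_lt[_ [U [oU AU] <-] h]; exists U.
Qed.

Let om_sigma : sigma_subadditive om.
Proof.
move=> A; apply/lee_addgt0Pr => e e0.
have e'0 n : (0 < e / (2 ^ n.+1)%:R)%R by rewrite divr_gt0// ltr0n expn_gt0.
have [U hU] := choice (fun n => om_approx (A n) (e'0 n)).
apply: (@le_trans _ _ (io (\bigcup_n U n))).
  apply: om_le; first by apply: bigcup_open => i _; have [] := hU i.
  by apply: subset_bigcup => i _; have [] := hU i.
apply: (@le_trans _ _ (\sum_(i <oo) io (U i))).
  by apply: io_bigcup => i; have [] := hU i.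
apply: (@le_trans _ _ (\sum_(i <oo) (om (A i) + (e / (2 ^ i.+1)%:R)%:E))).
  by apply: lee_nneseries => // i _; have [_ _ /ltW] := hU i.
by apply: epsilon_trick => //; exact: ltW.
Qed.

HB.instance Definition _ := isOuterMeasure.Build R T om
  (etrans (om_open open0) io0) om_ge0 le_om om_sigma.

(** For an open [W] around [A], first [C] is chosen inside both [W] and [U], then [D] inside [W]
    minus [C], an open set that contains [W] minus [U]. As [C] and [D] are disjoint subsets of [W],
    [m C + m D] is at most [io W]. *)
Let om_caratheodory U : open U -> caratheodory_measurable om U.
Proof.
move=> oU; apply: le_caratheodory_measurable => A.
apply/lee_addgt0Pr => e e0.
have [W [oW AW We]] := om_approx A e0.
apply: le_trans (ltW We).
apply: (@le_trans _ _ (io (W `&` U) + om (W `\` U))).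
  by apply: leeD; [apply: om_le; [exact: openI|exact: setSI]|
    apply: le_om; rewrite -setDE; exact: setSD].
rewrite -leeBrDr//; apply: ge_ereal_sup => _ [C [cC CWU] <-].
rewrite leeBrDr//.
have clC : closed C by have [] := Cl_clopen cC.
apply: (@le_trans _ _ (m C + io (W `\` C))).
  apply: leeD2l; apply: om_le.
    by rewrite setDE; apply: openI => //; exact: closed_openC.
  by move=> x [Wx nUx]; split=> // /CWU[].
rewrite addeC -leeBrDr ?m_fin//; apply: ge_ereal_sup => _ [D [cD DW] <-].
rewrite leeBrDr ?m_fin// -mD//; last first.
  by apply/seteqP; split=> // x [/DW[]].
apply: m_io; first exact: ClU.
by move=> x [/DW[]|/CWU[]].
Qed.

Let om_measurable (B : set (borel_type T)) : measurable B ->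
  caratheodory_measurable om B.
Proof.
apply: smallest_sub; last by move=> U; exact: om_caratheodory.
split.
- exact: (@caratheodory_measurable_set0 _ _ om).
- move=> A mA; rewrite setTD.
  exact: (@caratheodory_measurable_setC _ _ om).
- exact: (@caratheodory_measurable_bigcup _ _ om).
Qed.

Let bm : set (borel_type T) -> \bar R := om.

Let bm_sigma : semi_sigma_additive bm.
Proof.
move=> F mF tF mUF.
apply: (@caratheodory_measure_sigma_additive R T om) => //.
- by move=> i; exact: om_measurable.
- exact: om_measurable.
Qed.

HB.instance Definition _ := isMeasure.Build _ (borel_type T) R bm
  (etrans (om_open open0) io0) om_ge0 bm_sigma.

Let bm_finite : fin_num_fun bm.
Proof. by move=> A _; exact: om_fin. Qed.

HB.instance Definition _ := Measure_isFinite.Build _ (borel_type T) R bm bm_finite.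

(** Inner regularity at [B] is outer regularity at its complement: an open [U] slightly larger than
    the complement of [B] has itself a compact complement inside [B]. The lower bound on clopen sets
    will give strict positivity. *)
Lemma radon_extension : exists mu : {finite_measure set (borel_type T) -> \bar R},
  radon mu /\ forall C, Cl C -> m C <= mu C.
Proof.
exists bm; split; last first.
  by move=> C cC; rewrite /= /bm om_open; [exact: m_io|have [] := Cl_clopen cC].
move=> B mB; apply/eqP; rewrite eq_le; apply/andP; split; last first.
  by apply: ge_ereal_sup => _ [C [_ CB] <-]; exact: le_om.
apply/lee_addgt0Pr => e e0.
have [U [oU BU Ue]] := om_approx (~` B) e0.
have clU : closed (~` U) by exact: open_closedC.
have bmD : bm B + bm (~` B) = bm (~` U) + bm U.
  have hB := om_measurable mB setT; have hU := om_caratheodory oU setT.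
  by rewrite /bm [RHS]addeC; rewrite !setTI in hB hU; rewrite -hB -hU.
have : bm B <= bm (~` U) + e%:E.
  rewrite -(leeD2rE _ _ (om_fin (~` B))) -/bm bmD -addeA leeD2l//.
  by rewrite /bm (om_open oU) addeC ltW.
move=> /le_trans; apply; apply: leeD2r; apply: ereal_sup_ubound.
exists (~` U) => //; split; first exact: (subclosed_compact clU cptT).
by apply: subsetCl.
Qed.

End RadonExtension.

(** * Digits of real numbers *)

(* Any bases [b i] with [\sum_i 1 / b i] finite would do. *)
Definition base (i : nat) : nat := (2 ^ i.+2)%N.

Definition base_prod (n : nat) : nat := (\prod_(i < n) base i)%N.

Lemma base_gt0 i : (0 < base i)%N.
Proof. by rewrite expn_gt0. Qed.

Lemma base_gt1 i : (1 < base i)%N.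
Proof. by rewrite /base -[X in (X < _)%N](expn0 2) ltn_exp2l. Qed.

Lemma base_prodS n : base_prod n.+1 = (base_prod n * base n)%N.
Proof. by rewrite /base_prod big_ord_recr. Qed.

Lemma base_prod_gt0 n : (0 < base_prod n)%N.
Proof. by apply: prodn_gt0 => i; exact: base_gt0. Qed.

Lemma sum_divn_modn (f g : nat -> nat) (n d : nat) : (0 < d)%N ->
  (\sum_(k < n * d) f (k %/ d) * g (k %% d) =
   (\sum_(k < n) f k) * (\sum_(c < d) g c))%N.
Proof.
move=> d0; elim: n => [|n IH]; first by rewrite mul0n !big_ord0 mul0n.
rewrite mulSnr big_split_ord/= big_ord_recr/= mulnDl; congr addn.
  by rewrite -IH; apply: eq_bigr.
rewrite big_distrr/=; apply: eq_bigr => c _.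
by rewrite divnMDl// divn_small// addn0 modnMDl modn_small.
Qed.

Section Digits.
Variable R : realType.
Implicit Types (x y : R) (P Q : pred nat) (D : nat -> pred nat).

Local Notation lambda := (@lebesgue_measure R).

Definition scaled_floor m x : int := Num.floor (x * (base_prod m)%:R).

(** The [i]-th digit after the radix point in the mixed radix expansion with bases [base i]. The
    integer remainder makes it meaningful for negative [x] too, as the nonmeager set may lie
    anywhere on the line. *)
Definition digit i x : nat := `|(scaled_floor i.+1 x %% (base i)%:Z)%Z|%N.

Lemma digit_lt i x : (digit i x < base i)%N.
Proof.
rewrite /digit -ltz_nat gez0_abs ?modz_ge0 ?ltz_pmod ?ltz_nat ?base_gt0//.
by rewrite -lt0n base_gt0.
Qed.

Lemma scaled_floorS m x :
  scaled_floor m x = (scaled_floor m.+1 x %/ (base m)%:Z)%Z.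
Proof.
set k := scaled_floor m.+1 x; apply: floor_def.
have b0 : (0 : R) < (base m)%:R by rewrite ltr0n base_gt0.
have := floor_itv (x * (base_prod m.+1)%:R); rewrite -/(scaled_floor m.+1 x) -/k.
rewrite base_prodS natrM mulrA; set y := x * _ => /andP[ky yk].
have bz : (base m)%:Z != 0 by rewrite eqz_nat -lt0n base_gt0.
have kE := divz_eq k (base m)%:Z.
have r0 := modz_ge0 k bz.
have rb := @ltz_pmod k (base m)%:Z.
rewrite ltz_nat base_gt0 in rb; move: (rb isT) => {}rb.
apply/andP; split.
- rewrite -(ler_pM2r b0); apply: le_trans ky.
  by rewrite -[(base m)%:R]/((base m)%:Z%:~R) -intrM ler_int {2}kE lerDl.
- rewrite -(ltr_pM2r b0); apply: lt_le_trans yk _.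
  rewrite -[(base m)%:R]/((base m)%:Z%:~R) -intrM ler_int {1}kE mulrDl mul1r.
  by rewrite -addrA lerD2l -ltzD1 ltrD2r.
Qed.

Lemma scaled_floor_eq_le n m x y : (n <= m)%N ->
  scaled_floor m x = scaled_floor m y -> scaled_floor n x = scaled_floor n y.
Proof.
elim: m => [|m IH]; first by rewrite leqn0 => /eqP ->.
rewrite leq_eqVlt => /orP[/eqP -> //|nm e]; apply: IH => //.
by rewrite (scaled_floorS m x) e -scaled_floorS.
Qed.

Lemma eq_scaled_floor_digit i m x y : (i < m)%N ->
  scaled_floor m x = scaled_floor m y -> digit i x = digit i y.
Proof. by move=> im /(scaled_floor_eq_le im) e; rewrite /digit e. Qed.

Lemma scaled_floor_ge0 m x : (0 <= scaled_floor m x) = (0 <= x).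
Proof. by rewrite /scaled_floor floor_ge0 pmulr_lge0// ltr0n base_prod_gt0. Qed.

Lemma digit_unit i x : 0 <= x ->
  digit i x = (`|scaled_floor i.+1 x| %% base i)%N.
Proof.
rewrite -(scaled_floor_ge0 i.+1) /digit; case: (scaled_floor _ _) => // k _.
by rewrite modz_nat !absz_nat.
Qed.

Lemma absz_scaled_floorS m x : 0 <= x ->
  `|scaled_floor m x|%N = (`|scaled_floor m.+1 x| %/ base m)%N.
Proof.
rewrite -(scaled_floor_ge0 m.+1) (scaled_floorS m).
case: (scaled_floor _ _) => // k _.
by rewrite divz_nat !absz_nat.
Qed.

(** Here [k] numbers an interval of level [m]: its last digit is the remainder modulo [base m'], and
    the quotient numbers the enclosing interval of level [m']. *)
Fixpoint digits_ok D m (k : nat) : bool :=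
  if m is m'.+1 then digits_ok D m' (k %/ base m')%N && D m' (k %% base m')%N
  else true.

Lemma digits_okP D m x : 0 <= x ->
  (forall i, (i < m)%N -> D i (digit i x)) <->
  digits_ok D m `|scaled_floor m x|%N.
Proof.
move=> x0; elim: m => [|m IH]/=; first by split.
rewrite -absz_scaled_floorS// -digit_unit//; split=> [h|/andP[/IH h hm] i].
  by apply/andP; split; [apply/IH => i im; apply: h; exact: ltnW|exact: h].
by rewrite ltnS leq_eqVlt => /orP[/eqP -> //|]; exact: h.
Qed.

Lemma count_digits_ok D m :
  (\sum_(k < base_prod m) digits_ok D m k =
   \prod_(i < m) \sum_(c < base i) D i c)%N.
Proof.
elim: m => [|m IH]; first by rewrite /base_prod !big_ord0 big_ord1.
rewrite big_ord_recr/= -IH base_prodS -(sum_divn_modn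
  (fun k => digits_ok D m k : nat) (fun c => D m c : nat) _ (base_gt0 m)).
by apply: eq_bigr => k _; rewrite mulnb.
Qed.

(** The cut-off [n] allows an induction that adds one interval of level [m] at a time;
    [n = base_prod m] gives the unit interval. *)
Let level m P n : set R :=
  [set x | [/\ 0 <= x, x < n%:R / (base_prod m)%:R & P `|scaled_floor m x|%N]].

Let levelS m P n : level m P n.+1 = level m P n `|`
  (if P n then `[n%:R / (base_prod m)%:R, n.+1%:R / (base_prod m)%:R[%classic
   else set0).
Proof.
have B0 : (0 : R) < (base_prod m)%:R by rewrite ltr0n base_prod_gt0.
have fl x : n%:R / (base_prod m)%:R <= x < n.+1%:R / (base_prod m)%:R ->
    `|scaled_floor m x|%N = n.
  rewrite ler_pdivrMr// ltr_pdivlMr// => h.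
  by rewrite /scaled_floor (@floor_def _ _ n%:Z)// intrD; rewrite -natr1 in h.
apply/seteqP; split=> x.
- move=> [x0 xn Px]; have [xn'|xn'] := ltP x (n%:R / (base_prod m)%:R).
    by left.
  right; move: Px; rewrite fl ?xn'// => ->.
  by rewrite /= in_itv/= xn'.
- move=> [[x0 xn Px]|].
    split=> //; apply: lt_le_trans xn _.
    by rewrite ler_pM2r ?invr_gt0// ler_nat.
  case: ifP => // Pn; rewrite /= in_itv/= => h; have /andP[h1 h2] := h.
  split=> //; last by rewrite fl.
  by apply: le_trans h1; rewrite divr_ge0// ?ler0n// ltW.
Qed.

Let level_measure m P n : measurable (level m P n) /\
  lambda (level m P n) = ((\sum_(k < n) P k)%:R / (base_prod m)%:R)%:E.
Proof.
have B0 : (0 : R) < (base_prod m)%:R by rewrite ltr0n base_prod_gt0.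
elim: n => [|n [IHm IH]].
  have -> : level m P 0 = set0.
    apply/seteqP; split=> // x [x0]; rewrite mul0r => x1.
    by move: (le_lt_trans x0 x1); rewrite ltxx.
  by rewrite big_ord0 mul0r measure0.
have mI : measurable (if P n then
    `[n%:R / (base_prod m)%:R, n.+1%:R / (base_prod m)%:R[%classic : set R
    else set0).
  by case: ifP.
rewrite levelS; split; first exact: measurableU.
rewrite measureU//; last first.
  apply/seteqP; split=> // x [[_ h _]]; case: ifP => // _.
  by rewrite /= in_itv/= leNgt h.
rewrite big_ord_recr/= natrD mulrDl EFinD; congr (_ + _)%E => //.
case: ifP => _; last by rewrite measure0 mul0r.
rewrite lebesgue_measure_itv/= lte_fin ltr_pM2r ?invr_gt0// ltr_nat ltnSn.
by rewrite -EFinB -mulrBl -natrB// subSnn.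
Qed.

Definition density P i : R := (\sum_(c < base i) P c)%:R / (base i)%:R.

Definition digit_cylinder D m : set R :=
  [set x | 0 <= x < 1 /\ forall i, (i < m)%N -> D i (digit i x)].

Let digit_cylinderE D m :
  digit_cylinder D m = level m (digits_ok D m) (base_prod m).
Proof.
have B0 : ((base_prod m)%:R : R) != 0 by rewrite pnatr_eq0 -lt0n base_prod_gt0.
apply/seteqP; split=> x; rewrite /level/= divff//.
  by move=> [/andP[x0 x1] /(digits_okP D m x0)].
by move=> [x0 x1 h]; split; [rewrite x0|exact/digits_okP].
Qed.

Lemma measurable_digit_cylinder D m : measurable (digit_cylinder D m).
Proof. by rewrite digit_cylinderE;
  have [] := level_measure m (digits_ok D m) (base_prod m). Qed.

Lemma lebesgue_digit_cylinder D m :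
  lambda (digit_cylinder D m) = (\prod_(i < m) density (D i) i)%:E.
Proof.
rewrite digit_cylinderE (level_measure _ _ _).2 count_digits_ok; congr EFin.
rewrite prodf_div natr_prod; congr (_ / _).
by rewrite /base_prod natr_prod.
Qed.

Lemma density_ge0 P i : 0 <= density P i.
Proof. by rewrite divr_ge0. Qed.

Lemma densityT i : density xpredT i = 1.
Proof.
by rewrite /density sum1_card card_ord divff// pnatr_eq0 -lt0n base_gt0.
Qed.

Lemma densityC P i : density (predC P) i = 1 - density P i.
Proof.
rewrite -(densityT i) /density -mulrBl -natrB; last first.
  by apply: leq_sum => c _; exact: leq_b1.
congr (_%:R / _).
rewrite -sumnB; last by move=> c _; exact: leq_b1.
by apply: eq_bigr => c _ /=; case: (P c).
Qed.

Lemma le_density P Q i : (forall c, (c < base i)%N -> P c -> Q c) ->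
  density P i <= density Q i.
Proof.
move=> PQ; rewrite ler_pM2r ?invr_gt0 ?ltr0n ?base_gt0// ler_nat.
by apply: leq_sum => c _; case: (P c) (PQ c (ltn_ord c)) => // ->.
Qed.

Lemma density_le1 P i : density P i <= 1.
Proof. by rewrite -(densityT i); exact: le_density. Qed.

Lemma densityU P Q i : density (predU P Q) i <= density P i + density Q i.
Proof.
rewrite /density -mulrDl -natrD -big_split/= ler_pM2r ?invr_gt0 ?ltr0n ?base_gt0//.
by rewrite ler_nat; apply: leq_sum => c _; rewrite /in_mem/=; case: (P c);
  case: (Q c).
Qed.

Lemma density1 a i : density (pred1 a) i <= (base i)%:R^-1.
Proof.
rewrite /density ler_piMl ?invr_ge0// -[leRHS]/(1%:R) ler_nat.
rewrite (eq_bigr (fun c : 'I__ => if c == a :> nat then 1%N else 0%N)); last first.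
  by move=> c _ /=; case: eqP.
rewrite -big_mkcond/= sum1_card; apply/card_le1_eqP => c d.
by move=> /eqP ca /eqP da; apply/val_inj; rewrite /= ca da.
Qed.

Lemma density1_in a i : (a < base i)%N -> density (pred1 a) i = (base i)%:R^-1.
Proof.
move=> ab; apply/eqP; rewrite eq_le density1/= /density.
rewrite ler_peMl ?invr_ge0// -[leLHS]/(1%:R) ler_nat.
by rewrite (bigD1 (Ordinal ab))//= eqxx.
Qed.

Lemma density_lt1_ex P i : density P i < 1 -> exists2 c, (c < base i)%N & ~~ P c.
Proof.
move=> h; apply: contrapT => h'; move: h; apply/negP; rewrite -leNgt -(densityT i).
apply: le_density => c ci _; apply: contrapT => nP; apply: h'.
by exists c => //; apply/negP.
Qed.

End Digits.

(** * Summable slaloms *)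

Section Slaloms.
Variable R : realType.
Implicit Types (x y : R) (S T : nat -> pred nat).

Local Notation lambda := (@lebesgue_measure R).
Local Notation width S i := (density R (S i) i).

Definition summable_slalom S := exists C : R, forall n, \sum_(i < n) width S i <= C.

(* The values [S i c] with [c >= base i] are irrelevant. *)
Definition almost_sub S T :=
  exists k, forall i c, (k <= i)%N -> (c < base i)%N -> S i c -> T i c.

Definition limsup_digits S : set R :=
  [set x | 0 <= x < 1 /\ forall k, exists2 i, (k <= i)%N & S i (digit i x)].

Lemma almost_sub_trans T S U : almost_sub S T -> almost_sub T U -> almost_sub S U.
Proof.
move=> [k hk] [l hl]; exists (maxn k l) => i c; rewrite geq_max => /andP[ki li] ci.
by move=> /(hk _ _ ki ci); exact: hl.
Qed.

Lemma sum_width_cat S k n : (k <= n)%N ->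
  \sum_(i < n) width S i = \sum_(i < k) width S i + \sum_(k <= i < n) width S i.
Proof. by move=> kn; rewrite -!(big_mkord xpredT (fun i =>
  width S i)) -big_cat_nat. Qed.

Lemma sum_width_ge0 S k n : 0 <= \sum_(k <= i < n) width S i.
Proof. by apply: sumr_ge0 => i _; exact: density_ge0. Qed.

Lemma summable_tail S (e : R) : summable_slalom S -> 0 < e ->
  exists k, forall n, \sum_(k <= i < n) width S i <= e.
Proof.
move=> [C hC] e0.
pose E := range (fun n => \sum_(i < n) width S i).
have supE : has_sup E.
  by split; [exists (\sum_(i < 0) width S i); exists 0%N|exists C => _ [n _ <-]].
have [_ [k _ <-] hk] := sup_adherent e0 supE.
exists k => n; have [kn|nk] := leqP k n; last first.
  by rewrite big_geq ?ltW// ltnW.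
have : \sum_(i < n) width S i <= sup E by apply: ub_le_sup; [exact: supE.2|exists n].
by rewrite (sum_width_cat _ kn); lra.
Qed.

Lemma summableU S T : summable_slalom S -> summable_slalom T ->
  summable_slalom (fun i => predU (S i) (T i)).
Proof.
move=> [C hC] [D hD]; exists (C + D) => n; apply: le_trans (lerD (hC n) (hD n)).
rewrite -big_split/=; apply: ler_sum => i _; exact: densityU.
Qed.

Lemma summable1 (a : nat -> nat) : summable_slalom (fun i => pred1 (a i)).
Proof.
exists 1 => n.
(* The sharper bound [1 - 2 ^- n] is inductive, because [1 / base n] is at most
   [2 ^- n - 2 ^- n.+1]. *)
apply: (@le_trans _ _ (1 - (2 ^- n))); last by rewrite gerBl invr_ge0 exprn_ge0.
elim: n => [|n IH]; first by rewrite big_ord0 expr0 invr1 subrr.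
rewrite big_ord_recr/=.
have h := density1 R (a n) n.
have : (base n)%:R^-1 <= 2 ^- n - 2 ^- n.+1 :> R.
  rewrite /base natrX !exprS; have := exprn_gt0 n (ltr0Sn R 1).
  rewrite !invfM; set u := 2 ^+ n => u0.
  have : 0 < u^-1 by rewrite invr_gt0.
  by set v := u^-1; lra.
by lra.
Qed.

Lemma summable0 S : (forall i c, ~~ S i c) -> summable_slalom S.
Proof.
move=> S0; exists 0 => n; rewrite big1// => i _;
  rewrite /density big1 ?mul0r// => c _.
by rewrite (negbTE (S0 _ _)).
Qed.

(** The Borel-Cantelli lemma for the sets [F i], which restrict only the digit [i] and have measure
    [width S i]. *)
Lemma limsup_digits_null S : summable_slalom S ->
  lambda.-negligible (limsup_digits S).
Proof.
move=> [C hC].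
pose F i : set R := digit_cylinder (fun j => if j == i then S i else xpredT) i.+1.
have mF i : measurable (F i) by exact: measurable_digit_cylinder.
have FE i : lambda (F i) = (width S i)%:E.
  rewrite lebesgue_digit_cylinder big_ord_recr/= eqxx big1 ?mul1r// => j _.
  by rewrite ltn_eqF// densityT.
exists (lim_sup_set F); split.
- apply: bigcapT_measurable => m.
  by apply: bigcup_measurable => j _; exact: mF.
- apply: lim_sup_set_cvg0 => //.
  apply: le_lt_trans (ltry C); apply: lime_le.
    exact: is_cvg_nneseries.
  apply: nearW => n; rewrite big_mkord.
  rewrite (eq_bigr (fun i : 'I_n => (width S i)%:E)); last by move=> i _; exact: FE.
  by rewrite sumEFin lee_fin; exact: hC.
- move=> x [x01 hx] k _; have [i ki Si] := hx k; exists i => //; split=> //.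
  move=> j; rewrite ltnS leq_eqVlt => /orP[/eqP ->|ji]; first by rewrite eqxx.
  by rewrite ltn_eqF.
Qed.

(** The slalom [T j] enters [S] only at positions [i] with [j <= i] and [k j <= i], where its tail
    sums to at most [2 ^- j]. Exchanging the two sums bounds the total by 2. *)
Lemma diagonal_slalom (T : nat -> nat -> pred nat) :
  (forall j, summable_slalom (T j)) ->
  exists2 S, summable_slalom S & forall j, almost_sub (T j) S.
Proof.
move=> hT.
have e0 j : 0 < 2 ^- j :> R by rewrite invr_gt0 exprn_gt0.
have [k hk] := choice (fun j => summable_tail (hT j) (e0 j)).
pose S i c := has (fun j => (k j <= i)%N && T j i c) (iota 0 i.+1).
exists S; last first.
  move=> j; exists (maxn j (k j)) => i c; rewrite geq_max => /andP[ji ki] _ Tc.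
  by apply/hasP; exists j; rewrite ?mem_iota ?add0n ?ltnS// ki.
exists 2 => n.
have wS i : (i < n)%N -> width S i <= \sum_(j < n) (if (k j <= i)%N then width (T
  j) i else 0).
  move=> ni; rewrite -(big_mkord xpredT (fun j =>
    if (k j <= i)%N then width (T j) i else 0)).
  rewrite (@big_cat_nat _ _ _ i.+1)//= -[leLHS]addr0; apply: lerD; last first.
    by apply: sumr_ge0 => j _; case: ifP => // _; exact: density_ge0.
  rewrite /S /index_iota subn0; elim: (iota 0 i.+1) => [|j s IH]/=.
    by rewrite big_nil /density big1 ?mul0r.
  rewrite big_cons; apply: le_trans (densityU _ _ _ _) _; apply: lerD IH.
  by case: ifP => _ //=; rewrite /density big1 ?mul0r.
apply: (@le_trans _ _ (\sum_(i < n) \sum_(j < n) (if (k j <= i)%N then width (T j)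
  i else 0))).
  by apply: ler_sum => i _; exact: wS.
rewrite exchange_big/=.
apply: (@le_trans _ _ (\sum_(j < n) 2 ^- j)).
  apply: ler_sum => j _; apply: le_trans (hk j n).
  rewrite -(big_mkord xpredT (fun i =>
    if (k j <= i)%N then width (T j) i else 0)) -big_mkcond/=.
  have [kn|nk] := leqP (k j) n; last first.
    rewrite [leRHS]big_geq ?(ltnW nk)// big_nat_cond big_pred0// => i.
    by apply/negbTE; lia.
  rewrite (@big_cat_nat _ _ _ (k j))//= big_nat_cond big_pred0; last first.
    by move=> i; apply/negbTE; lia.
  by rewrite add0r big_nat_cond [leRHS]big_nat_cond le_eqVlt; apply/orP; left;
    apply/eqP; apply: eq_bigl => i; case: (k j <= i)%N; rewrite ?andbT ?andbF.
have -> : \sum_(j < n) 2 ^- j = 2 - 2 * 2 ^- n :> R.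
  elim: n {wS} => [|n IH]; first by rewrite big_ord0 expr0 invr1 mulr1 subrr.
  rewrite big_ord_recr/= IH exprS invfM; lra.
by rewrite gerBl mulr_ge0// ltW.
Qed.

(** A positive lower bound on the product thus bounds the sum: positive measure yields summability.
    The induction uses that [(1 + s + w) * (1 - w)] equals [1 + s - w * (s + w)]. *)
Lemma sum_prod_onem S m :
  (1 + \sum_(i < m) width S i) * \prod_(i < m) (1 - width S i) <= 1.
Proof.
elim: m => [|m IH]; first by rewrite !big_ord0 addr0 mul1r.
rewrite !big_ord_recr/=.
have p0 : 0 <= \prod_(i < m) (1 - width S i).
  by apply: prodr_ge0 => i _; rewrite subr_ge0 density_le1.
have s0 : 0 <= \sum_(i < m) width S i by apply: sumr_ge0 => i _; exact: density_ge0.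
have w0 := density_ge0 R (S m) m; have w1 := density_le1 R (S m) m.
move: IH p0 s0 w0 w1; set p := \prod_(_ < _) _; set s := \sum_(_ < _) _.
set w := density _ _ _ => IH p0 s0 w0 w1.
apply: le_trans IH; rewrite mulrA -subr_ge0.
rewrite (_ : _ - _ = p * (w * (s + w))); last by ring.
by rewrite !mulr_ge0// addr_ge0.
Qed.

(** Weierstrass' product inequality, for the converse direction: a small sum of widths yields
    positive measure. *)
Lemma prod_onem_ge S n m : (n <= m)%N ->
  1 - \sum_(n <= i < m) width S i <= \prod_(n <= i < m) (1 - width S i) <= 1.
Proof.
elim: m => [|m IH]; first by rewrite leqn0 => /eqP ->; rewrite !big_geq// subr0 lexx.
rewrite leq_eqVlt => /orP[/eqP ->|]; first by rewrite !big_geq// subr0 lexx.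
rewrite ltnS => nm; have /andP[IH1 IH2] := IH nm; rewrite !big_nat_recr//=.
have w0 := density_ge0 R (S m) m; have w1 := density_le1 R (S m) m.
have p0 : 0 <= \prod_(n <= i < m) (1 - width S i).
  by apply: prodr_ge0 => i _; rewrite subr_ge0 density_le1.
move: IH1 IH2 p0 w0 w1; set p := \prod_(_ <= _ < _) _; set s := \sum_(_ <= _ < _) _.
set w := density _ _ _ => IH1 IH2 p0 w0 w1.
have pw : 0 <= p * w <= w by rewrite mulr_ge0//= ler_piMl.
by apply/andP; split; move: pw; lra.
Qed.

Definition avoiding (z : nat -> nat) n S : set R :=
  [set x | [/\ 0 <= x < 1, forall i, (i < n)%N -> digit i x = z i &
    forall i, (n <= i)%N -> ~~ S i (digit i x)]].

Lemma avoidingE z n S : avoiding z n S =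
  \bigcap_m digit_cylinder (fun i =>
    if (i < n)%N then pred1 (z i) else predC (S i)) m.
Proof.
apply/seteqP; split=> x.
  move=> [x01 h1 h2] m _; split=> // i _.
  by have [ni|ni] := ltnP i n; [rewrite /= h1|exact: h2].
move=> h; split; first by have [] := h 0%N I.
- by move=> i ni; have [_ /(_ i (leqnn _))] := h i.+1 I; rewrite ni => /eqP.
- by move=> i ni; have [_ /(_ i (leqnn _))] := h i.+1 I; rewrite ltnNge ni.
Qed.

Lemma measurable_avoiding z n S : measurable (avoiding z n S).
Proof.
rewrite avoidingE; apply: bigcapT_measurable => m.
exact: measurable_digit_cylinder.
Qed.

(** The finite approximations decrease to the set, and each has measure at least [c / 2]: the
    prescribed digits contribute [c], the avoided ones a factor of at least one half. *)
Lemma lebesgue_avoiding_gt0 z n S : (forall i, (i < n)%N -> (z i < base i)%N) ->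
  (forall m, \sum_(n <= i < m) width S i <= 2^-1) ->
  (0 < lambda (avoiding z n S))%E.
Proof.
move=> hz hS; set D := fun i => if (i < n)%N then pred1 (z i) else predC (S i).
pose c : R := \prod_(i < n) (base i)%:R^-1.
have c0 : 0 < c by apply: prodr_gt0 => i _; rewrite invr_gt0 ltr0n base_gt0.
have F m : (n <= m)%N -> ((c / 2)%:E <= lambda (digit_cylinder D m))%E.
  move=> nm; rewrite lebesgue_digit_cylinder lee_fin.
  rewrite -(big_mkord xpredT (fun i => density R (D i) i)) (@big_cat_nat _ _ _ n)//=.
  apply: ler_pM => //; first exact: ltW.
    rewrite big_mkord /c le_eqVlt; apply/orP; left; apply/eqP; apply: eq_bigr => i _.
    by rewrite /D ltn_ord density1_in// hz.
  rewrite big_nat_cond (eq_bigr (fun i => 1 - width S i)); last first.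
    by move=> i /andP[/andP[ni _] _]; rewrite /D ltnNge ni/= densityC.
  rewrite -big_nat_cond; have /andP[h _] := prod_onem_ge S nm.
  by have := hS m; lra.
have fin0 : (lambda (digit_cylinder D 0) < +oo)%E.
  by rewrite lebesgue_digit_cylinder ltry.
have cvgD : (lambda \o digit_cylinder D) @ \oo --> lambda (avoiding z n S).
  rewrite avoidingE; apply: nonincreasing_cvg_mu.
  - exact: fin0.
  - by move=> i; exact: measurable_digit_cylinder.
  - by rewrite -avoidingE; exact: measurable_avoiding.
  - move=> i j ij; apply/subsetPset => x [x01 h]; split=> // k ki.
    by apply: h; exact: leq_trans ij.
apply: (@lt_le_trans _ _ (c / 2)%:E); first by rewrite lte_fin divr_gt0.
rewrite -(cvg_lim _ cvgD)//; apply: lime_ge; first by apply/cvg_ex; eexists;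
  exact: cvgD.
by exists n => // m /= nm; exact: F.
Qed.

End Slaloms.

(** * Localization of slaloms with null limsup sets, and digits of nonmeager sets *)

Section Localization.
Variable R : realType.
Implicit Types (x y : R) (S T : nat -> pred nat).

Local Notation lambda := (@lebesgue_measure R).

(** The points at which some [scaled_floor m] jumps. *)
Definition base_rationals : set R :=
  range (fun p : nat * int => p.2%:~R / (base_prod p.1)%:R).

Lemma base_rationals_negligible : lambda.-negligible base_rationals.
Proof.
have cQ : countable base_rationals.
  by apply: sub_countable (countableP [set: nat * int]); exact: card_image_le.
exists base_rationals; split=> //; last exact: countable_lebesgue_measure0.
exact: countable_measurable.
Qed.

Lemma near_scaled_floor m x : ~ base_rationals x ->
  \forall y \near x, scaled_floor m y = scaled_floor m x.
Proof.
move=> Qx; set k := scaled_floor m x.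
have B0 : (0 : R) < (base_prod m)%:R by rewrite ltr0n base_prod_gt0.
have /andP[kx xk] := floor_itv (x * (base_prod m)%:R).
have kx' : k%:~R < x * (base_prod m)%:R.
  rewrite lt_neqAle kx andbT; apply/eqP => kE; apply: Qx.
  by exists (m, k) => //=; rewrite kE mulfK// gt_eqF.
have : x \in `]k%:~R / (base_prod m)%:R, (k + 1)%:~R / (base_prod m)%:R[.
  by rewrite in_itv/= ltr_pdivrMr// ltr_pdivlMr// kx' xk.
move=> /near_in_itvoo; apply: filterS => y.
rewrite in_itv/= ltr_pdivrMr// ltr_pdivlMr// => /andP[ky yk].
by apply: floor_def; rewrite ltW.
Qed.

Let cyl (s : seq nat) : set R := digit_cylinder (fun i =>
  pred1 (nth 0%N s i)) (size s).

(* Away from [base_rationals] the digits are continuous, so the branch of the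
   tree of digits that is built from the [y k] belongs to the limit of the [y k]. *)
Lemma branch_limit (U : set R) S (y : nat -> R) (n : nat -> nat) :
  open U -> base_rationals `<=` U ->
  (forall k, 0 <= y k < 1 /\ ~ U (y k)) ->
  (forall k, (k <= n k)%N) ->
  (forall k l, (k <= l)%N -> forall j,
    (j < n k)%N -> digit j (y l) = digit j (y k)) ->
  (forall k, exists2 j, (n k <= j < n k.+1)%N & S j (digit j (y k.+1))) ->
  exists2 x, ~ U x & limsup_digits S x.
Proof.
move=> oU QU yU kn agree hit.
have [x [/= + clx]] : `[0, 1]%classic `&` cluster (y @ \oo) !=set0.
  apply: segment_compact; exists 0%N => // k _ /=.
  by have [/andP[y0 y1] _] := yU k; rewrite in_itv/= y0 ltW.
rewrite in_itv/= => /andP[x0 x1].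
have Ux : ~ U x.
  move=> Ux; have [_ [[k _ <-] Uy]] : range y `&` U !=set0.
    by apply: clx; [exists 0%N => // k _; exists k|exact: open_nbhs_nbhs].
  by have [_] := yU k.
have Qx : ~ base_rationals x by move/QU.
(* The limit could only leave the half-open interval at 1, which is a base rational and so belongs
   to [U]. *)
have x1' : x < 1.
  rewrite lt_neqAle x1 andbT; apply/eqP => xE; apply: Qx.
  by exists (0%N, 1) => //=; rewrite /base_prod big_ord0 divr1 xE.
exists x => //; split; first by rewrite x0.
move=> K; have [j /andP[nj jn] Sj] := hit K.
exists j; first exact: leq_trans (kn K) nj.
(* Some late [y l] is so close to [x] that they share the digit [j], and that digit no longer
   changes after [y K.+1]. *)
have [_ [[l Kl <-] yl]] : [set y l | l in [set l | (K.+1 <= l)%N]] `&`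
    [set v | scaled_floor j.+1 v = scaled_floor j.+1 x] !=set0.
  by apply: clx; [exists K.+1 => // l /= Kl; exists l|exact: near_scaled_floor].
by rewrite -(eq_scaled_floor_digit (ltnSn j) yl) (agree _ _ Kl).
Qed.

Lemma localization (I : Type) (S : I -> nat -> pred nat) :
  lambda.-negligible (\bigcup_i limsup_digits (S i)) ->
  exists2 T, summable_slalom R T & forall i, almost_sub (S i) T.
Proof.
move=> nullS.
(* [M] is a null measurable set around all the limsup sets and the base rationals, and [U] an open
   set around [M] of measure below one half; hence [E0] has positive measure. *)
have [M [mM M0 NM]] := negligibleU nullS base_rationals_negligible.
have Mfin : (lambda M < +oo)%E by rewrite M0.
have half0 : (0 : R) < 2^-1 by rewrite invr_gt0.
have [U [oU MU Ue]] := lebesgue_regularity_outer mM Mfin half0.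
have mU : measurable U by exact: open_measurable.
have mI : measurable (`[0, 1[%classic : set R) by [].
pose E0 := `[0, 1[%classic `\` U.
have mE0 : measurable E0 by exact: measurableD.
have E0_gt0 : (0 < lambda E0)%E.
  rewrite lt0e measure_ge0 andbT; apply/eqP => E00.
  have : (lambda `[0%R, 1%R[%classic <= lambda E0 + (lambda (U `\` M) + lambda M))%E.
    have mUM : measurable (U `\` M) by exact: measurableD.
    have mUMM : measurable ((U `\` M) `|` M) by exact: measurableU.
    have mW : measurable (E0 `|` ((U `\` M) `|` M)) by exact: measurableU.
    have h1 : (lambda (E0 `|` ((U `\` M) `|` M)) <=
      lambda E0 + lambda ((U `\` M) `|` M))%E by exact: measureU2.
    have h2 : (lambda ((U `\` M) `|` M) <= lambda (U `\` M) + lambda M)%E.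
      exact: measureU2.
    apply: le_trans (le_trans h1 (leeD2l _ h2)).
    apply: le_measure; [exact/mem_set|exact/mem_set|] => x x01.
    have [Ux|nUx] := pselect (U x); last by left.
    by right; have [Mx|nMx] := pselect (M x); [right|left].
  rewrite E00 M0 adde0 add0e lebesgue_measure_itv/= lte01 oppr0 adde0.
  move=> /(le_lt_trans)/(_ Ue); rewrite lte_fin; lra.
(* There are countably many words, so removing all null portions of [E0] costs a null set only.
   Afterwards a cylinder that meets [E] cuts [E0] in positive measure. *)
pose F n := if (choice.unpickle n : option (seq nat)) is Some s then
  if lambda (cyl s `&` E0) == 0 then cyl s `&` E0 else set0 else set0.
have mcyl s : measurable (cyl s `&` E0).
  by apply: measurableI => //; exact: measurable_digit_cylinder.
have [B [mB B0 FB]] : lambda.-negligible (\bigcup_n F n).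
  apply: negligible_bigcup => n; rewrite /F.
  case: choice.unpickle => [s|]; last exact: negligible_set0.
  case: ifPn => [/eqP h|_]; last exact: negligible_set0.
  by exists (cyl s `&` E0); split; [exact: (mcyl s)|exact: h|].
pose E := E0 `\` B.
have E_cyl s y : E y -> cyl s y -> (0 < lambda (cyl s `&` E0))%E.
  move=> [E0y nBy] sy; rewrite lt0e measure_ge0 andbT; apply/negP => h.
  by apply: nBy; apply: FB; exists (choice.pickle s) => //;
    rewrite /F choice.pickleK h.
have [y0 Ey0] : E !=set0.
  apply/set0P/negP => /eqP EE; move: E0_gt0; rewrite ltNge => /negP; apply.
  rewrite -B0; apply: le_measure; [exact/mem_set|exact/mem_set|] => x E0x.
  by apply: contrapT => nB; have : E x by []; rewrite EE.
(* The digits that the portion of [E] in the cylinder of [s] never takes at a position beyond [s].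
   Every digit is missing from an empty portion, which the second clause therefore excludes. *)
pose Ts s i c := `[< [/\ (size s <= i)%N, exists2 y, E y & cyl s y &
  forall y, E y -> cyl s y -> digit i y != c] >].
have sumTs s : summable_slalom R (Ts s).
  have [[y Ey sy]|nosy] := pselect (exists2 y, E y & cyl s y); last first.
    by apply: summable0 => i c; apply/asboolPn => -[].
  have d0 := E_cyl _ _ Ey sy; have dfin : lambda (cyl s `&` E0) \is a fin_num.
    rewrite ge0_fin_numE//; apply: (@le_lt_trans _ _ (lambda `[0%R, 1%R[%classic)).
      by apply: le_measure; [exact: (mem_set (mcyl s))|exact: (mem_set mI)|] =>
        x [_ [h _]].
    by rewrite lebesgue_measure_itv/= lte01 oppr0 adde0 ltry.
  set d := fine (lambda (cyl s `&` E0)).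
  have {}d0 : 0 < d by rewrite fine_gt0// d0 ltey_eq dfin.
  (* Up to the null set [B], the portion lies in the cylinder whose first [n] digits avoid [Ts s].
     So its measure [d] is at most the product, and [sum_prod_onem] bounds the sum by [1 / d]. *)
  exists d^-1 => n.
  have : d <= \prod_(i < n) (1 - density R (Ts s i) i).
    pose D i := predC (Ts s i).
    have mD : measurable (digit_cylinder D n : set R) by exact:
      measurable_digit_cylinder.
    rewrite -lee_fin fineK//.
    have -> : ((\prod_(i < n) (1 - density R (Ts s i) i))%:E =
        lambda (digit_cylinder D n) + lambda B)%E.
      rewrite B0 adde0 lebesgue_digit_cylinder; congr EFin.
      by apply: eq_bigr => i _; rewrite densityC.
    have h1 : (lambda (digit_cylinder D n `|` B) <=
      lambda (digit_cylinder D n) + lambda B)%E by exact: measureU2.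
    have mDB : measurable (digit_cylinder D n `|` B : set R) by exact: measurableU.
    apply: le_trans h1; apply: le_measure;
      [exact: (mem_set (mcyl s))|exact: (mem_set mDB)|].
    move=> x [sx E0x]; have [Bx|nBx] := pselect (B x); first by right.
    left; have [x01 _] := E0x; split; first by move: x01; rewrite /= in_itv.
    move=> i _ /=; apply/asboolPn => -[_ _ /(_ x)]; rewrite eqxx.
    by move=> /(_ (conj E0x nBx) sx).
  have := sum_prod_onem R (Ts s) n; set p := \prod_(_ < _) _; set q := \sum_(_ < _) _.
  have q0 : 0 <= q by apply: sumr_ge0 => i _; exact: density_ge0.
  move=> h1 dp; rewrite -(ler_pM2r d0) mulVf ?gt_eqF//.
  apply: le_trans h1; apply: (@le_trans _ _ (q * p)); first by rewrite ler_wpM2l.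
  by rewrite mulrDl mul1r lerDr (le_trans (ltW d0)).
pose Tn n := if (choice.unpickle n : option (seq nat)) is Some s then Ts s else fun
  _ _ => false.
have sumTn n : summable_slalom R (Tn n).
  by rewrite /Tn; case: choice.unpickle => [s //|]; apply: summable0.
have [T sumT TT] := diagonal_slalom sumTn.
exists T => // i; suff [s hs] : exists s, almost_sub (S i) (Ts s).
  by apply: almost_sub_trans (TT (choice.pickle s)); rewrite /Tn choice.pickleK.
apply: contrapT => noS.
(* As [S i] is not almost contained in [Ts s] for the first [n] digits [s] of [y], some digit of
   [S i] at a position [j >= n] is taken by a point of [E] that agrees with [y] below [n]. Iteration
   yields a branch whose limit is outside [U] and yet in the limsup set of [S i]. *)
have step (p : {p : R * nat | E p.1}) : exists q : {p : R * nat | E p.1},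
    (forall j, (j < (sval p).2)%N -> digit j (sval q).1 = digit j (sval p).1) /\
    exists2 j, ((sval p).2 <= j < (sval q).2)%N & S i j (digit j (sval q).1).
  case: p => -[y n]/= Ey; set s := mkseq (fun k => digit k y) n.
  apply: contrapT => noq; apply: noS; exists s, n => j c nj cj Sc.
  apply/asboolP; split; first by rewrite size_mkseq.
    exists y => //; split; first by have [[]] := Ey; rewrite /= in_itv.
    by move=> k; rewrite size_mkseq => kn /=; rewrite nth_mkseq.
  move=> y' Ey' [_ sy']; apply/eqP => y'c; apply: noq.
  exists (exist _ (y', j.+1) Ey') => /=; split.
    move=> k kn; have := sy' k; rewrite size_mkseq => /(_ kn) /eqP.
    by rewrite nth_mkseq.
  by exists j; rewrite ?nj ?ltnSn ?y'c.
have [f hf] := choice step.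
pose u k := iter k f (exist _ (y0, 0%N) Ey0).
pose y k := (sval (u k)).1; pose n k := (sval (u k)).2.
have nS k : (n k < n k.+1)%N.
  by have [_ [j /andP[h1 h2] _]] := hf (u k); exact: leq_ltn_trans h2.
have kn k : (k <= n k)%N by elim: k => // k IH; exact: leq_ltn_trans (nS k).
have nmono k l : (k <= l)%N -> (n k <= n l)%N.
  by move=> kl; rewrite -(subnKC kl); elim: (l - k)%N => [|d IH];
    rewrite ?addn0// addnS (leq_trans IH)// ltnW.
have [||||x nUx Sx] := @branch_limit U (S i) y n oU _ _ kn.
- by move=> x Qx; apply: MU; apply: NM; right.
- move=> k; have [[yk nUy] _] : E (y k) := svalP (u k).
  by split=> //; move: yk; rewrite /= in_itv.
- move=> k l kl j jn; rewrite -(subnKC kl); elim: (l - k)%N => [|d IH].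
    by rewrite addn0.
  rewrite addnS -IH; have [h _] := hf (u (k + d)%N); apply: h.
  by apply: leq_trans jn _; apply: nmono; exact: leq_addr.
- by move=> k; have [_] := hf (u k).
by apply: nUx; apply: MU; apply: NM; left; exists i.
Qed.

Lemma nowhere_denseS (T : topologicalType) (A B : set T) : A `<=` B ->
  nowhere_dense B -> nowhere_dense A.
Proof.
move=> AB nB; apply/seteqP; split=> // x hx.
by rewrite -[set0]nB; apply: interiorS hx; exact: closureS.
Qed.

Lemma ltn_base_prod n : (n < base_prod n)%N.
Proof.
elim: n => [|n IH]; first exact: base_prod_gt0.
rewrite base_prodS; have := leq_mul (leqnn (base_prod n)) (base_gt1 n); lia.
Qed.

Lemma nowhere_dense_avoid_digits k (d : nat -> nat) :
  (forall i, (d i < base i)%N) ->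
  nowhere_dense [set x : R | forall i, (k <= i)%N -> digit i x != d i].
Proof.
move=> hd; set A := [set x | _]; apply/seteqP; split=> // x.
rewrite /interior /= => /nbhs_ballP[e /= e0 eA].
have [i ki ie] : exists2 i, (k <= i)%N & ((base_prod i)%:R^-1 : R) < e.
  exists (maxn k (Num.truncn e^-1).+1); first exact: leq_maxl.
  set i := maxn _ _; have i0 : (0 : R) < (base_prod i)%:R by rewrite ltr0n
    base_prod_gt0.
  rewrite invf_plt// ?posrE//; apply: lt_le_trans (truncnS_gt _) _.
  by rewrite ler_nat; apply: leq_trans (ltnW (ltn_base_prod i)); exact: leq_maxr.
have B0 : (0 : R) < (base_prod i)%:R by rewrite ltr0n base_prod_gt0.
have b0 : (0 : R) < (base i)%:R by rewrite ltr0n base_gt0.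
have B'0 : (0 : R) < (base_prod i.+1)%:R by rewrite ltr0n base_prod_gt0.
set m := scaled_floor i x.
have /andP[mx xm] := floor_itv (x * (base_prod i)%:R);
  rewrite -/(scaled_floor i x) -/m in mx xm.
(* Inside the interval of level [i] around [x], [l] numbers the subinterval with digit [d i]. Its
   midpoint [v] is closer than [e] to [x], while its interior misses [A]. *)
pose l : int := m * (base i)%:Z + (d i)%:Z.
pose v : R := (l%:~R + 2^-1) / (base_prod i.+1)%:R.
have vV : v \in `]l%:~R / (base_prod i.+1)%:R, (l + 1)%:~R / (base_prod i.+1)%:R[.
  rewrite in_itv/= !ltr_pM2r ?invr_gt0// intrD; lra.
have lE : l%:~R = m%:~R * (base i)%:R + (d i)%:R :> R by rewrite intrD intrM.
have d1 : (d i)%:R + 1 <= (base i)%:R :> R by rewrite natr1 ler_nat hd.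
have d0 : 0 <= (d i)%:R :> R by [].
have vx : closure A v.
  apply: eA; rewrite /ball/= distrC.
  apply: lt_trans ie; rewrite -(ltr_pM2r B0) mulVf ?gt_eqF//.
  rewrite -[X in _ * X]gtr0_norm// -normrM mulrBl.
  have -> : v * (base_prod i)%:R = m%:~R + ((d i)%:R + 2^-1) / (base i)%:R.
    rewrite /v base_prodS natrM lE; field.
    by rewrite !gt_eqF.
  pose w : R := ((d i)%:R + 2^-1) / (base i)%:R.
  rewrite ltr_norml -/w; have : 0 < w < 1.
    rewrite /w; apply/andP; split; last by rewrite ltr_pdivrMr// mul1r; lra.
    by apply: divr_gt0 => //; lra.
  move: xm; rewrite intrD; move: mx; set u := x * _.
  by move=> h1 h2 h3; apply/andP; split; lra.
have [a [Aa]] := vx _ (near_in_itvoo vV).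
rewrite /= in_itv/= ltr_pdivrMr// ltr_pdivlMr// => /andP[la al].
have := Aa _ ki; rewrite /digit.
have -> : scaled_floor i.+1 a = l by apply: floor_def; rewrite ltW.
by rewrite modzMDl modz_small ?absz_nat ?eqxx//= ltz_nat.
Qed.

(** Otherwise every point of [X] avoids some [D j] from some [k] on, and [X] is a countable union of
    nowhere dense sets. *)
Lemma nonmeager_infinitely_often (X : set R) (D : nat -> nat -> nat) :
  ~ meager X -> (forall j i, (D j i < base i)%N) ->
  exists2 x, X x & forall j k, exists2 i, (k <= i)%N & digit i x = D j i.
Proof.
move=> mX hD; apply: contrapT => noX; apply: mX.
exists (fun n => if (choice.unpickle n : option (nat * nat)) is Some p then
  X `&` [set x | forall i, (p.2 <= i)%N -> digit i x != D p.1 i] else set0).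
  move=> n; case: choice.unpickle => [[j k]|].
    apply: nowhere_denseS (nowhere_dense_avoid_digits k (hD j)).
    exact: subIsetr.
  by rewrite /nowhere_dense closure0 interior0.
apply/seteqP; split=> [x Xx|x [n _]]; last by case: choice.unpickle => [p []|].
apply: contrapT => nx; apply: noX; exists x => // j k; apply: contrapT => ni.
apply: nx; exists (choice.pickle (j, k)) => //; rewrite choice.pickleK;
  split=> // i ki.
by apply/eqP => e; apply: ni; exists i.
Qed.

End Localization.

(** * Well-orders with small initial segments *)

Section WellOrders.
Local Open Scope card_scope.

Definition strict_well_order (L : Type) (lt : L -> L -> Prop) : Prop :=
  [/\ well_founded lt, forall a b c, lt a b -> lt b c -> lt a c &
    forall a b, lt a b \/ a = b \/ lt b a].

Lemma exists_strict_well_order (X : eqType) :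
  exists lt : X -> X -> Prop, strict_well_order lt.
Proof.
have [le wo] := wochoice.well_ordering_principle X.
have wo' : wochoice.wo_chain le (pred_of_argType X) by apply: wochoice.withinW.
have tot := wochoice.wo_chainW wo'.
have anti := wochoice.wo_chain_antisymmetric wo'.
have min (A : set X) : A !=set0 -> exists2 z, A z & forall x, A x -> le z x.
  move=> [x Ax]; have [|z [[Az hz] _]] := wo [pred x | `[< A x >]].
    by exists x; apply/asboolP.
  by exists z => [|y Ay]; [exact/asboolP|apply: hz; apply/asboolP].
exists (fun a b => le a b /\ a <> b); split.
- move=> a; apply: contrapT => na.
  have [|z nz hz] := min [set a | ~ Acc (fun a b => le a b /\ a <> b) a].
    by exists a.
  apply: nz; constructor => b [bz nbz]; apply: contrapT => nb.
  by apply: nbz; apply: anti => //; rewrite bz hz.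
- move=> a b c [ab nab] [bc nbc].
  have [|z [->|[->|->]] hz] := min [set x | x = a \/ (x = b \/ x = c)].
  + by exists a; left.
  + split; first by apply: hz; right; right.
    by move=> ac; apply: nbc; apply: anti => //; rewrite bc -ac ab.
  + by exfalso; apply: nab; apply: anti => //; rewrite ab hz//; left.
  + by exfalso; apply: nbc; apply: anti => //; rewrite bc hz//; right; left.
- move=> a b; have [->|/eqP nab] := eqVneq a b; first by right; left.
  have /orP[ab|ba] : le a b || le b a by exact: tot.
    by left.
  by right; right; split=> // e; apply: nab.
Qed.

Lemma strict_well_order_min (L : Type) (lt : L -> L -> Prop) (A : set L) :
  strict_well_order lt -> A !=set0 ->
  exists2 z, A z & forall x, A x -> ~ lt x z.
Proof.
move=> [wf _ _] [x Ax]; elim: (wf x) Ax => {}x _ IH Ax.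
have [[y Ay yx]|nx] := pselect (exists2 y, A y & lt y x); first exact: IH Ay.
by exists x => // y Ay yx; apply: nx; exists y.
Qed.

(** A well-order of [Y] is cut at the least point whose initial segment already has size [kappa], if
    there is one; what remains has the type of an initial ordinal. The map [x] transports [Y] onto
    the shortened order. *)
Lemma initial_well_order (X : pointedType) (U : Type) (kappa : set U) (Y : set X) :
  Y #= kappa ->
  exists (L : choiceType) (lt : L -> L -> Prop) (x : L -> X),
    [/\ strict_well_order lt, forall a, ~ (kappa #<= [set b | lt b a]) & range x = Y].
Proof.
move=> Yk; have [lt ltwo] := exists_strict_well_order X.
have [wf tr tri] := ltwo.
suff [Z [ZY Zseg]] : exists Z : set X, Z #= Y /\
    forall a, Z a -> ~ (kappa #<= [set b | Z b /\ lt b a]).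
  have /card_set_bijP[f [fY _ fZ]] := ZY.
  exists (set_type Z), (fun a b => lt (val a) (val b)), (f \o val); split.
  - split=> [a|a b c|a b]; [|exact: tr|].
      suff h r : Acc lt r -> forall c : Z, val c = r ->
        Acc (fun c d : Z => lt (val c) (val d)) c by exact: (h (val a)).
      elim=> {}r _ IH c cr; constructor => d dc; apply: (IH (val d)) => //.
      by rewrite -cr.
    have [h|[/val_inj ->|h]] := tri (val a) (val b); [by left|by right;
      left|by right; right].
  - move=> a ka; apply: (Zseg (val a)); first exact: set_valP.
    apply: card_le_trans ka _.
    have /card_esym/card_eqPle : (val : Z -> X) @` [set b : Z | lt (val b) (val a)] #=
      [set b : Z | lt (val b) (val a)] by apply: inj_card_eq => ? ? _ _;
        exact: val_inj.
    move=> [h _]; apply: card_le_trans h (subset_card_le _).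
    by move=> _ [b /= ba <-]; split=> //; exact: set_valP.
  - apply/seteqP; split=> [_ [z _ <-]|y /fZ[z Zz <-]].
      by apply: fY; exact: set_valP.
    by exists (exist _ z (mem_set Zz)).
have [[a ka]|na] := pselect (exists a, kappa #<= [set b | Y b /\ lt b a]); last first.
  by exists Y; split=> [|a _ ka]; [exact: card_eqxx|apply: na; exists a].
have [|z kz hz] := @strict_well_order_min X lt [set a | kappa #<= [set b | Y b /\
  lt b a]] ltwo.
  by exists a.
exists [set b | Y b /\ lt b z]; split.
  apply/card_eqPle; split.
    by apply: subset_card_le => b [].
  by rewrite (card_le_eql Yk).
move=> b [_ bz] kb; apply: (hz b) => //=; apply: card_le_trans kb _.
by apply: subset_card_le => c [[]].
Qed.

End WellOrders.

(** * Transfinite recursion for the tower of slaloms *)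

Section Tower.
Variable R : realType.
Implicit Types (x : R) (S T : nat -> pred nat).

Lemma summable_escape S : summable_slalom R S ->
  exists2 y : nat -> nat, (forall i, (y i < base i)%N) &
    exists k, forall i, (k <= i)%N -> ~~ S i (y i).
Proof.
move=> sS; have half0 : (0 : R) < 2^-1 by rewrite invr_gt0.
have [k hk] := summable_tail sS half0.
have [|y hy] := choice (_ : forall i, exists c, (c < base i)%N /\
    ((k <= i)%N -> ~~ S i c)).
  move=> i; have [ki|ik] := leqP k i; last by exists 0%N; split; rewrite ?base_gt0.
  have [|c ci Sc] := @density_lt1_ex R (S i) i; last by exists c.
  have := hk i.+1; rewrite big_nat_recr//=.
  have := sum_width_ge0 R S k i; lra.
by exists y => [i|]; [have [] := hy i|exists k => i ki; have [_] := hy i; exact].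
Qed.

Lemma slalom_tower (L : Type) (lt : L -> L -> Prop) (x : L -> R) :
  strict_well_order lt ->
  (forall a (F : L -> nat -> pred nat),
    (forall b, lt b a -> summable_slalom R (F b)) ->
    exists2 T, summable_slalom R T & forall b, lt b a -> almost_sub (F b) T) ->
  exists (S : L -> nat -> pred nat) (y : L -> nat -> nat), forall a,
    [/\ summable_slalom R (S a),
        forall b, lt b a -> almost_sub (S b) (S a),
        forall i, S a i (digit i (x a)),
        forall i, (y a i < base i)%N /\ S a i (y a i) &
        forall b, lt b a -> exists k, forall i, (k <= i)%N -> ~~ S b i (y a i)].
Proof.
move=> [wf _ _] dir.
pose good a (F : L -> nat -> pred nat) (p : (nat -> pred nat) * (nat -> nat)) :=
  [/\ summable_slalom R p.1,
    forall b, lt b a -> almost_sub (F b) p.1,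
    forall i, p.1 i (digit i (x a)),
    forall i, (p.2 i < base i)%N /\ p.1 i (p.2 i) &
    forall b, lt b a -> exists k, forall i, (k <= i)%N -> ~~ F b i (p.2 i)].
have step a F : exists p, (forall b, lt b a -> summable_slalom R (F b)) -> good a F p.
  have [hF|nF] := pselect (forall b, lt b a -> summable_slalom R (F b)); last first.
    (* A dummy value, which makes the choice below total; the induction [fgood] shows that it is
       never taken. *)
    by exists (fun _ => xpred0, fun _ => 0%N).
  have [T sT FT] := dir a F hF.
  have [y yb [k hy]] := summable_escape sT.
  (* The digits of [x a] are added so that [S a] captures them. The sequence [y] escapes [T], hence
     from some point on each earlier slalom; it is added as a witness that the new level is strictly
     larger. *)
  exists (fun i c => T i c || (c == digit i (x a)) || (c == y i), y).
  move=> _; split=> /=.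
  - exact: (summableU (summableU sT (summable1 R (fun i =>
    digit i (x a)))) (summable1 R y)).
  - move=> b ba; apply: almost_sub_trans (FT b ba) _.
    by exists 0%N => i c _ _ ->.
  - by move=> i; rewrite eqxx orbT.
  - by move=> i; split; rewrite ?yb// eqxx orbT.
  - move=> b ba; have [l hl] := FT b ba; exists (maxn k l) => i.
    rewrite geq_max => /andP[ki li]; apply: contra (hy i ki).
    exact: hl.
(* The history below [a] is extended by empty slaloms to all of [L], the form in which [step] takes
   it. *)
pose ext a (rec : forall b, lt b a -> (nat -> pred nat) * (nat -> nat)) b :=
  if pselect (lt b a) is left h then (rec b h).1 else fun _ => xpred0.
pose next a rec := sval (cid (step a (ext a rec))).
pose f := Fix wf _ next.
have fE a : f a = next a (fun b _ => f b).
  rewrite /f Fix_eq// => b g h gh; congr (next b _).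
  by apply: functional_extensionality_dep => c;
    apply: functional_extensionality_dep => bc.
have fgood a : good a (fun b => (f b).1) (f a).
  elim: (wf a) => {}a _ IH.
  have extE b : lt b a -> ext a (fun b _ => f b) b = (f b).1.
    by move=> ba; rewrite /ext; case: pselect.
  have [|h1 h2 h3 h4 h5] := svalP (cid (step a (ext a (fun b _ => f b)))).
    by move=> b ba; rewrite extE//; have [] := IH b ba.
  rewrite -/(next a (fun b _ => f b)) -fE in h1 h2 h3 h4 h5.
  split=> // b ba; rewrite -extE//; [exact: h2|exact: h5].
by exists (fun a => (f a).1), (fun a => (f a).2) => a; exact: fgood.
Qed.

End Tower.

(** * Topologies generated by clopen tests, sequences, orders, cubes *)

(* [T] with the coarsest topology that makes every set [v^~ j] clopen; unlike a
   subspace of [J -> bool], it needs no embedding of [T]. *)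
Definition test_space (T J : Type) (v : T -> J -> bool) : Type := T.

Section TestTopology.
Variables (T J : Type) (v : T -> J -> bool).
Local Notation X := (test_space v).

HB.instance Definition _ := gen_eqMixin X.
HB.instance Definition _ := gen_choiceMixin X.

Definition agree (js : seq J) (p q : T) := all (fun j => v q j == v p j) js.

Let test_open (U : set X) := forall p, U p -> exists js, forall q,
  agree js p q -> U q.

Let test_openT : test_open setT.
Proof. by move=> p _; exists [::]. Qed.

Let test_openI : setI_closed test_open.
Proof.
move=> U V oU oV p [/oU[js hjs] /oV[ks hks]]; exists (js ++ ks) => q.
by rewrite /agree all_cat => /andP[/hjs ? /hks ?].
Qed.

Let test_open_bigU (I : Type) (f : I -> set X) :
  (forall i, test_open (f i)) -> test_open (\bigcup_i f i).
Proof.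
by move=> of_ p [i _ /of_[js hjs]]; exists js => q /hjs ?; exists i.
Qed.

HB.instance Definition _ := isOpenTopological.Build X test_openT test_openI
  test_open_bigU.

Lemma agree_refl js p : agree js p p.
Proof. by rewrite /agree; elim: js => //= j js ->; rewrite eqxx. Qed.

Lemma agree_cons j js p q : agree (j :: js) p q = (v q j == v p j) && agree js p q.
Proof. by []. Qed.

Lemma open_testE (U : set X) :
  open U <-> forall p, U p -> exists js, forall q, agree js p q -> U q.
Proof. by []. Qed.

Lemma nbhs_testP (p : X) (U : set X) :
  nbhs p U <-> exists js, forall q, agree js p q -> U q.
Proof.
rewrite nbhsE; split=> [[V [oV Vp] VU]|[js hjs]].
  by have [js hjs] := oV p Vp; exists js => q /hjs /VU.
exists [set q | agree js p q]; last exact: hjs.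
split; last exact: agree_refl.
move=> q /= pq; exists js => r qr; elim: js pq qr {hjs} => //= j js IH.
by move=> /andP[/eqP e pq] /andP[/eqP -> qr]; rewrite e eqxx IH.
Qed.

Lemma cvg_test (F : set_system X) (p : X) : Filter F ->
  (forall j, F [set q | v q j = v p j]) -> F --> p.
Proof.
move=> FF Fj U /nbhs_testP[js hjs]; suff : F [set q | agree js p q] by apply: filterS.
elim: js {hjs} => [|j js IH]; first by apply: filterS filterT.
by apply: filterS2 (Fj j) IH => q /= -> ->; rewrite eqxx.
Qed.

Definition tests (l : seq (J * bool)) : set X :=
  [set q | all (fun x => v q x.1 == x.2) l].

Lemma clopen_tests l : clopen (tests l).
Proof.
suff oC (P : pred (J -> bool)) js : (forall u w, all (fun j =>
  u j == w j) js -> P u = P w) ->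
    open [set q : X | P (v q)].
  have loc u w : all (fun j => u j == w j) [seq x.1 | x <- l] ->
      all (fun x : J * bool => u x.1 == x.2) l = all (fun x => w x.1 == x.2) l.
    by elim: l => //= x l IH /andP[/eqP -> /IH ->].
  split; first exact: (oC (fun u => all (fun x => u x.1 == x.2) l) _ loc).
  rewrite -[tests l]setCK; apply: open_closedC.
  have -> : ~` tests l = [set q | ~~ all (fun x => v q x.1 == x.2) l].
    by apply/seteqP; split=> q /= /negP.
  apply: (oC (fun u => ~~ all (fun x => u x.1 == x.2) l) [seq x.1 | x <- l]) =>
    u w /loc.
  by move=> ->.
by move=> hP; apply/open_testE => p Pp; exists js => q /hP; rewrite /= => ->.
Qed.

Lemma agreeE js p : [set q | agree js p q] = tests [seq (j, v p j) | j <- js].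
Proof. by apply/seteqP; split=> q; rewrite /tests/agree/= all_map. Qed.

Lemma hausdorff_test : injective v -> hausdorff_space X.
Proof.
move=> vinj p q clpq; apply: vinj; apply/funext => j.
have op (r : X) : nbhs r [set s : X | v s j = v r j].
  by apply/nbhs_testP; exists [:: j] => s /=; rewrite andbT => /eqP.
by have [r [/= <- <-]] := clpq _ _ (op p) (op q).
Qed.

End TestTopology.
Arguments tests {T J} v l.

(** The base point is a parameter of the type because Borel sets and measures live on pointed
    spaces. *)
Definition pointed_test_space (T J : Type) (v : T -> J -> bool) (p0 : T) : Type :=
  test_space v.

HB.instance Definition _ (T J : Type) (v : T -> J -> bool) (p0 : T) :=
  Topological.copy (pointed_test_space v p0) (test_space v).
HB.instance Definition _ (T J : Type) (v : T -> J -> bool) (p0 : T) :=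
  isPointed.Build (pointed_test_space v p0) p0.

Definition sequence_space (R : realType) : Type := nat -> nat.

Section SequenceMetric.
Variable R : realType.
Implicit Types x y z : sequence_space R.

HB.instance Definition _ := gen_eqMixin (sequence_space R).
HB.instance Definition _ := gen_choiceMixin (sequence_space R).

(** The ultrametric of Baire space: [1 / (k + 1)] for the first difference [k]. *)
Definition sequence_dist x y : R :=
  if pselect (exists k, x k != y k) is left h then (ex_minn h).+1%:R^-1 else 0.

Lemma sequence_dist_ge0 x y : 0 <= sequence_dist x y.
Proof. by rewrite /sequence_dist; case: pselect => // h; rewrite invr_ge0. Qed.

Lemma sequence_dist_lt x y n :
  sequence_dist x y < n.+1%:R^-1 <-> forall k, (k <= n)%N -> x k = y k.
Proof.
rewrite /sequence_dist; case: pselect => [h|nh]; last first.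
  split=> [_ k _|_]; last by rewrite invr_gt0.
  by apply/eqP/negPn/negP => e; apply: nh; exists k.
case: ex_minnP => m xm mmin; rewrite ltf_pV2 ?posrE// ltr_nat ltnS.
split=> [nm k kn|e].
  apply/eqP/negPn/negP => /mmin; rewrite leqNgt (leq_ltn_trans kn)//.
by rewrite ltnNge; apply/negP => /e /eqP; rewrite (negbTE xm).
Qed.

Lemma sequence_dist_eq0 x y : sequence_dist x y = 0 <-> x = y.
Proof.
split=> [e|->].
  by apply/funext => n; apply: (sequence_dist_lt x y n).1 => //; rewrite e invr_gt0.
by rewrite /sequence_dist; case: pselect => // h; exfalso; case: h => k; rewrite eqxx.
Qed.

Lemma sequence_dist_sym x y : sequence_dist x y = sequence_dist y x.
Proof.
have le u v : sequence_dist u v <= sequence_dist v u.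
  rewrite leNgt; apply/negP => h; have := h; rewrite {2}/sequence_dist.
  case: pselect => [hu|_]; last by rewrite ltNge sequence_dist_ge0.
  case: ex_minnP => m um _ /sequence_dist_lt/(_ m (leqnn m)) e.
  by move: um; rewrite e eqxx.
by apply/eqP; rewrite eq_le !le.
Qed.

Lemma sequence_dist_triangle y x z :
  sequence_dist x z <= sequence_dist x y + sequence_dist y z.
Proof.
rewrite leNgt; apply/negP => h.
have h1 : sequence_dist x y < sequence_dist x z.
  by apply: le_lt_trans h; rewrite lerDl sequence_dist_ge0.
have h2 : sequence_dist y z < sequence_dist x z.
  by apply: le_lt_trans h; rewrite lerDr sequence_dist_ge0.
move: h1 h2; rewrite {2 4}/sequence_dist.
case: pselect => [hu|_]; last by rewrite ltNge sequence_dist_ge0.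
case: ex_minnP => m xm _ /sequence_dist_lt/(_ m (leqnn m)) e.
by move=> /sequence_dist_lt/(_ m (leqnn m)); rewrite -e => e'; rewrite e' eqxx in xm.
Qed.

HB.instance Definition _ := isMetric.Build R (sequence_space R)
  (fun x => (sequence_dist_eq0 x x).2 erefl)
  (fun x y => (sequence_dist_eq0 x y).1)
  sequence_dist_sym sequence_dist_triangle.

Lemma nbhs_sequence x (U : set (sequence_space R)) : nbhs x U ->
  exists n, forall y, (forall k, (k <= n)%N -> x k = y k) -> U y.
Proof.
move=> /nbhs_ballP[e /= e0 eU]; exists (Num.truncn e^-1) => y /sequence_dist_lt h.
apply: eU; rewrite ballEmdist/=; apply: lt_trans h _.
by rewrite invf_plt ?posrE// truncnS_gt.
Qed.

End SequenceMetric.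

(** The identity is a homeomorphism onto the order topology of [le]: open rays are open in [T], and
    each neighbourhood contains an interval around its point. An endpoint [None] stands for an
    unbounded side. *)
Lemma linearly_orderable_of (T : topologicalType) (le : rel T) :
  reflexive le -> antisymmetric le -> transitive le -> total le ->
  (forall a x, ~~ le x a -> nbhs x [set w | ~~ le w a]) ->
  (forall b x, ~~ le b x -> nbhs x [set w | ~~ le b w]) ->
  (forall x U, nbhs x U -> exists lo hi : option T,
    [/\ if lo is Some a then ~~ le x a else true,
      if hi is Some b then ~~ le b x else true &
      forall w, (if lo is Some a then ~~ le w a else true) ->
        (if hi is Some b then ~~ le b w else true) -> U w]) ->
  linearly_orderable T.
Proof.
move=> refl anti tr tot nlo nhi bas.
pose P0 : porderType (Order.Disp tt tt) :=
  HB.pack (T : Type) (Choice.on T) (Order.Le_isPOrder.Build (Order.Disp tt tt) T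
    refl anti tr).
pose P : orderType (Order.Disp tt tt) :=
  HB.pack (T : Type) P0 (Order.POrder_isTotal.Build (Order.Disp tt tt) P0 tot).
have ltE (a b : P) : (a < b)%O = ~~ le b a by rewrite ltNge.
exists (Order.Disp tt tt), (order_topology P), id, id; split=> // x U.
  rewrite order_nbhs_itv => -[i [oi xi] iU]; apply: filterS iU _.
  case: i xi oi => -[[] a|[]] [[] b|[]] xi //= _; move: xi; rewrite in_itv/= ?ltE.
  - move=> /andP[h1 h2]; apply: filterS2 (nlo _ _ h1) (nhi _ _ h2) => w wa wb.
    suff : (w : P) \in `](a : P), (b : P)[ by [].
    by rewrite in_itv/= !ltE; apply/andP.
  - rewrite andbT => h1; apply: filterS (nlo _ _ h1) => w wa.
    suff : (w : P) \in `](a : P), +oo[ by [].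
    by rewrite in_itv/= ltE andbT.
  - move=> h2; apply: filterS (nhi _ _ h2) => w wa.
    suff : (w : P) \in `]-oo, (b : P)[ by [].
    by rewrite in_itv/= ltE.
  - by move=> _; apply: filterS filterT.
move=> /bas[lo [hi [xlo xhi h]]].
suff : nbhs (x : order_topology P) U by [].
rewrite order_nbhs_itv.
pose l : itv_bound P := if lo is Some a then BRight a else -oo%O.
pose r : itv_bound P := if hi is Some b then BLeft b else +oo%O.
exists (Interval l r).
  split; first by rewrite /l/r; case: (lo) => [?|]; case: (hi).
  rewrite itv_boundlr /l /r; case: (lo) xlo => [a|] xlo; case: (hi) xhi => [b|] xhi;
    by rewrite ?bnd_simp/= ?ltE ?xlo ?xhi.
move=> w wi; have : (w : P) \in Interval l r by [].
rewrite itv_boundlr /l /r => /andP[wl wr]; apply: h.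
  by case: (lo) wl => // a; rewrite bnd_simp ltE.
by case: (hi) wr => // b; rewrite bnd_simp ltE.
Qed.

Lemma set_type_hausdorff (X : topologicalType) (A : set X) :
  hausdorff_space X -> hausdorff_space (set_type A).
Proof.
move=> hX p q clpq; apply/val_inj/hX => U V nU nV.
have [r [Ur Vr]] := clpq _ _
  (@initial_continuous _ _ (set_val : A -> X) p U nU)
  (@initial_continuous _ _ (set_val : A -> X) q V nV).
by exists (val r).
Qed.

Section BooleanPoints.
Variables (R : realType) (W : Type).
Local Notation I01 := (set_type (`[0, 1]%classic : set R)).

Lemma cube_hausdorff : hausdorff_space (tychonoff_cube R W).
Proof.
apply: (@hausdorff_product {classic W} (fun=> I01)) => w.
by apply: set_type_hausdorff; exact: Rhausdorff.
Qed.

Lemma bit_in (b : bool) : (b%:R : R) \in (`[0, 1]%classic : set R).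
Proof. by apply/mem_set; rewrite /= in_itv/=; case: b; rewrite ?lexx ?ler01. Qed.

Definition boolean_point (y : W -> bool) : tychonoff_cube R W :=
  fun w => exist _ ((y w)%:R : R) (bit_in (y w)) : I01.

Lemma boolean_point_inj (y y' : W -> bool) w :
  boolean_point y w = boolean_point y' w -> y w = y' w.
Proof.
move=> /(congr1 val)/= /eqP; rewrite eqr_nat.
by case: (y w); case: (y' w).
Qed.

(** [c] is a set of prescribed bits, so its solutions form a cylinder of {0,1}^W. A set of pairs
    makes the union of two conditions, or of a sequence of them, immediate. *)
Definition satisfies (c : set (W * bool)) (y : W -> bool) :=
  forall w b, c (w, b) -> y w = b.

Definition consistent c := countable c /\ exists y, satisfies c y.

Lemma countable_setU T (A B : set T) : countable A -> countable B -> countable (A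
  `|` B).
Proof.
move=> cA cB; rewrite -bigcup2E; apply: bigcup_countable => // i _.
by rewrite /bigcup2; case: ifP => // _; case: ifP.
Qed.

Let near_bool (y : W -> bool) : set_system (W -> bool) :=
  [set A | exists2 c, countable c /\ satisfies c y & forall y',
    satisfies c y' -> A y'].

Let near_bool_filter y : Filter (near_bool y).
Proof.
split; first by exists set0 => //; split=> // w b [].
- move=> A B [c [cc cy] hc] [d [cd dy] hd]; exists (c `|` d).
    by split; [exact: countable_setU|move=> w b [/cy|/dy]].
  by move=> y' h; split; [apply: hc|apply: hd] => w b ?; apply: h; [left|right].
- by move=> A B AB [c h hc]; exists c => // y' /hc /AB.
Qed.

(** Convergence in a product is checked coordinatewise, and prescribing the single bit [y w] already
    fixes the coordinate [w]. *)
Lemma nbhs_boolean_point y (U : set (tychonoff_cube R W)) : nbhs (boolean_point y)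
  U ->
  exists2 c, countable c /\ satisfies c y &
    forall y', satisfies c y' -> U (boolean_point y').
Proof.
have FF := near_bool_filter y.
have cvy : boolean_point @ near_bool y --> boolean_point y.
  apply/cvg_sup => w V [_] [[V' oV' <-] V'y V'V].
  exists [set (w, y w)]; first by split; [exact: countable1|move=> _ _ [-> ->]].
  move=> y' /(_ w (y w) erefl) e; apply: V'V.
  suff : V' (boolean_point y' w) by [].
  have -> : boolean_point y' w = boolean_point y w.
    by apply/val_inj; rewrite /= e.
  exact: V'y.
exact: cvy.
Qed.

End BooleanPoints.

(** * The space of a tower of slaloms *)

Definition eventually_avoids (S : nat -> pred nat) (z : nat -> nat) :=
  exists k, forall i, (k <= i)%N -> ~~ S i (z i).

Lemma almost_sub_avoids S T z : (forall i, (z i < base i)%N) ->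
  almost_sub S T -> eventually_avoids T z -> eventually_avoids S z.
Proof.
move=> zb [k hk] [l hl]; exists (maxn k l) => i; rewrite geq_max => /andP[ki li].
by apply: contra (hl i li); exact: hk.
Qed.

(** The condition is boolean, so words form a countable type and are equal as soon as the sequences
    are. *)
Definition word :=
  {s : seq nat | all (fun i => nth 0 s i < base i)%N (iota 0 (size s))}.

Section TowerSpace.
Variables (L : Type) (lt : L -> L -> Prop).
Variables (S : L -> nat -> pred nat) (y : L -> nat -> nat).

(* [(z, g)] codes the ultrafilter of sets of words generated by the cylinders
   around [z] that contains, exactly for [a < g], the set of the words that
   extend [z|n] and avoid [S a] beyond [n], for some [n]. *)
Definition tower_point := {p : (nat -> nat) * L |
  (forall i, (p.1 i < base i)%N) /\ forall a,
    lt a p.2 -> eventually_avoids (S a) p.1}.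

Definition coord (q : word + tower_point) (i : nat) : option nat :=
  match q with
  | inl s => if (i < size (val s))%N then Some (nth 0%N (val s) i) else None
  | inr g => Some ((sval g).1 i)
  end.

(** Only points of the growth have a level; a word counts as lying above every [a]. *)
Definition below (a : L) (q : word + tower_point) : Prop :=
  if q is inr g then lt a (sval g).2 else True.

Definition avoids_from a n q :=
  below a q /\ forall i c, (n <= i)%N -> coord q i = Some c -> ~~ S a i c.

Definition tower_test (q : word + tower_point) (j : nat * nat + L * nat) : bool :=
  match j with
  | inl (i, c) => coord q i == Some c
  | inr (a, n) => `[< avoids_from a n q >]
  end.

Definition point_test (g : tower_point) := tower_test (inr g).

Lemma coord_lt q i c : coord q i = Some c -> (c < base i)%N.
Proof.
case: q => [[s hs]|[[z g] [zb _]]] /=; last by case=> <-.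
by case: ifP => // si [<-]; move/allP: hs; apply; rewrite mem_iota.
Qed.

Hypothesis wo : strict_well_order lt.
Hypothesis mono : forall a b, lt b a -> almost_sub (S b) (S a).
Hypothesis y_lt : forall a i, (y a i < base i)%N.
Hypothesis y_in : forall a i, S a i (y a i).
Hypothesis y_out : forall a b, lt b a -> eventually_avoids (S b) (y a).
Hypothesis capture : forall z : nat -> nat, (forall i, (z i < base i)%N) ->
  exists a, ~ eventually_avoids (S a) z.

Let lt_irr a : ~ lt a a.
Proof.
have [wf _ _] := wo; elim: (wf a) => {}a _ IH aa; exact: (IH _ aa aa).
Qed.

Let lt_tr b a c : lt a b -> lt b c -> lt a c.
Proof. by have [_ + _] := wo; exact. Qed.

Let lt_tri a b : lt a b \/ a = b \/ lt b a.
Proof. by have [_ _] := wo; exact. Qed.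

(** The coordinates determine a word, or the sequence [z] of a point. Two levels [a] and [b] over
    [z], [a] being the smaller, are told apart by the test [(a, k)] if [z] avoids [S a] from [k]
    on. *)
Lemma tower_test_inj : injective tower_test.
Proof.
move=> p q e.
have ec : coord p = coord q.
  apply/funext => i; case pi: (coord p i) => [c|].
    have := congr1 (fun f => f (inl (i, c))) e; rewrite /= pi eqxx => /esym/eqP ->.
    by [].
  case qi: (coord q i) => [c|//].
  by have := congr1 (fun f => f (inl (i, c))) e; rewrite /= pi qi eqxx.
case: p q e ec => [s|[[z g] [zb zg]]] [t|[[w h] [wb wh]]] e ec.
- congr inl; apply/val_inj.
  have sz u v : coord (inl u) = coord (inl v) -> (size (val u) <= size (val v))%N.
    move=> uv; rewrite leqNgt; apply/negP => h.
    by have := congr1 (fun f => f (size (val v))) uv; rewrite /= h ltnn.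
  have st : size (val s) = size (val t) by apply/eqP; rewrite eqn_leq !sz.
  apply: (@eq_from_nth _ 0%N) => // i si.
  by have := congr1 (fun f => f i) ec; rewrite /= si -st si => -[].
- by have := congr1 (fun f => f (size (val s))) ec; rewrite /= ltnn.
- by have := congr1 (fun f => f (size (val t))) ec; rewrite /= ltnn.
congr inr; apply: eq_exist.
have zw : z = w by apply/funext => i; have := congr1 (fun f => f i) ec => -[].
rewrite -{}zw in wb wh e ec *; congr pair.
have main a b (za : forall c, lt c a -> eventually_avoids (S c) z)
    (zb' : forall c, lt c b -> eventually_avoids (S c) z) : lt a b ->
    tower_test (inr (exist _ (z, a) (conj zb za))) =
    tower_test (inr (exist _ (z, b) (conj zb zb'))) -> False.
  move=> ab; have [k hk] := zb' a ab.
  move=> /(congr1 (fun f => f (inr (a, k))))/=.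
  have -> : `[< avoids_from a k (inr (exist _ (z, b) (conj zb zb'))) >].
    by apply/asboolP; split=> // i c ki [<-]; exact: hk.
  by move=> /asboolP[/lt_irr].
have [gh|[//|hg]] := lt_tri g h.
  by exfalso; apply: (main g h zg wh gh); rewrite e; congr (tower_test (inr _));
    apply: eq_exist.
by exfalso; apply: (main h g wh zg hg); rewrite e; congr (tower_test (inr _));
  apply: eq_exist.
Qed.

(* The digit [y g k] lies in [S a] for [a >= g] but, if [k] is large, not for [a < g];
   so one digit decides all of the finitely many tests [inr (a, _)] in [js]. *)
Lemma agree_far (g : tower_point) js : exists k0, forall k, (k0 <= k)%N -> forall q,
  (forall i, (i < k)%N -> coord q i = Some ((sval g).1 i)) ->
  coord q k = Some (y (sval g).2 k) -> avoids_from (sval g).2 k.+1 q ->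
  agree tower_test js (inr g) q.
Proof.
case: g => -[z g] [/= zb zg]; set p := inr _.
elim: js => [|j js [k1 IH]]; first by exists 0%N.
suff [k2 h2] : exists k2, forall k, (k2 <= k)%N -> forall q,
    (forall i, (i < k)%N -> coord q i = Some (z i)) -> coord q k = Some (y g k) ->
    avoids_from g k.+1 q -> tower_test q j = tower_test p j.
  exists (maxn k1 k2) => k; rewrite geq_max => /andP[k1k k2k] q h3 h4 h5.
  by rewrite /agree/= (h2 k)// eqxx; apply: (IH k).
case: j => [[i c]|[a m]].
  by exists i.+1 => k ik q h3 _ _; rewrite /= h3.
have [za|nza] := pselect (forall i, (m <= i)%N -> ~~ S a i (z i)); last first.
  have [i mi Sz] : exists2 i, (m <= i)%N & S a i (z i).
    apply: contrapT => h; apply: nza => i mi; apply/negP => Sz; apply: h.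
    by exists i.
  exists i.+1 => k ik q h3 _ _.
  transitivity false; last first.
    by apply/esym/asboolPn => -[_ /(_ i (z i) mi erefl)]; rewrite Sz.
  by apply/asboolPn => -[_ /(_ i (z i) mi)]; rewrite h3// Sz => /(_ erefl).
have [ag|nag] := pselect (lt a g).
  have [k1' hk1] := mono ag; have [k2' hk2] := y_out ag.
  exists (maxn m (maxn k1' k2')) => k;
    rewrite !geq_max => /and3P[mk k1k k2k] q h3 h4 [bq h5].
  transitivity true; last first.
    by apply/esym/asboolP; split=> // i c mi [<-]; exact: za.
  apply/asboolP; split.
    by case: q bq {h3 h4 h5} => //= h /(lt_tr ag).
  move=> i c mi qi; have [ik|] := ltnP i k.
    by move: qi; rewrite h3// => -[<-]; exact: za.
  rewrite leq_eqVlt => /orP[/eqP ki|ki].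
    by move: qi; rewrite -ki h4 => -[<-]; exact: hk2.
  apply: contra (h5 _ _ ki qi); apply: hk1; last exact: coord_lt qi.
  exact: leq_trans k1k (ltnW ki).
have [k1' hk1] : almost_sub (S g) (S a).
  have [//|[->|ga]] := lt_tri a g; last exact: mono.
  by exists 0%N.
exists (maxn m k1') => k; rewrite geq_max => /andP[mk k1k] q h3 h4 _.
transitivity false; last by apply/esym/asboolPn => -[].
apply/asboolPn => -[_ /(_ k _ mk h4)]; apply/negP; rewrite negbK.
exact: hk1.
Qed.

(** * Compactness, and the growth of the words *)

Section Ultra.
Variables (T : Type) (F : set_system T) (f : T -> word + tower_point).
Hypothesis UF : UltraFilter F.

Let Fcut (A : set T) : ~ F A -> F (~` A).
Proof. by have [//|] := in_ultra_setVsetC A UF. Qed.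

Let F_forall (A : nat -> set T) n : (forall i, (i < n)%N -> F (A i)) ->
  F [set t | forall i, (i < n)%N -> A i t].
Proof.
elim: n => [|n IH] h; first by apply: filterS filterT.
have h1 := IH (fun i ni => h i (ltnW ni)).
apply: filterS2 (h n (ltnSn n)) h1 => t An Ai i.
by rewrite ltnS leq_eqVlt => /orP[/eqP -> //|]; exact: Ai.
Qed.

Let undef i : set T := [set t | coord (f t) i = None].

Let F_coord i : ~ F (undef i) -> exists2 c,
  (c < base i)%N & F [set t | coord (f t) i = Some c].
Proof.
move=> Fi; apply: contrapT => nc; apply: Fi.
apply: filterS (F_forall (A := fun c =>
  ~` [set t | coord (f t) i = Some c]) (n := base i) _).
  move=> t ht; rewrite /undef/=; case e: (coord (f t) i) => [c|//].
  by have := ht c (coord_lt e).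
by move=> c ci; apply: Fcut => Fc; apply: nc; exists c.
Qed.

(** The length of the word is the least position undefined along [F]; each earlier position has
    finitely many possible digits, so its digit is constant on a member of [F]. *)
Let F_word : (exists i, F (undef i)) -> exists s, F [set t | f t = inl s].
Proof.
move=> [i0 Fi0]; have exF : exists i, `[< F (undef i) >] by exists i0; apply/asboolP.
case: (ex_minnP exF) => i /asboolP Fi imin {i0 Fi0 exF}.
have [|c hc] := @choice _ _ (fun j c => (j < i)%N ->
    (c < base j)%N /\ F [set t | coord (f t) j = Some c]).
  move=> j.
  have [ji|ij] := ltnP j i; last by exists 0%N.
  have [|c cj Fc] := @F_coord j; last by exists c.
  by move=> /asboolP/imin; rewrite leqNgt ji.
have [w [wi wc]] : exists w, size w = i /\ forall j, (j < i)%N -> nth 0%N w j = c j.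
  by exists (mkseq c i); split=> [|j ji]; rewrite ?size_mkseq ?nth_mkseq.
have vs : all (fun j => nth 0 w j < base j)%N (iota 0 (size w)).
  apply/allP => j; rewrite mem_iota wi add0n => ji.
  by rewrite wc//; have [] := hc j ji.
exists (exist _ w vs).
apply: filterS2 Fi (F_forall (fun j ji => (hc j ji).2)) => t.
rewrite /undef/=; case: (f t) => [[s hs]|//] /=; case: ifPn => // si _ h.
congr inl; apply: eq_exist.
have iE : size s = i.
  apply/eqP; rewrite eqn_leq leqNgt si/= leqNgt; apply/negP => h'.
  by have := h _ h'; rewrite ltnn.
apply: (@eq_from_nth _ 0%N) => [|j]; first by rewrite wi.
rewrite iE => ji.
by rewrite wc//; have := h j ji; rewrite iE ji => -[].
Qed.

(** If all digits are defined along [F], they converge to some [z], and the level of the limit is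
    the least [a] none of whose avoidance sets belongs to [F]; there is one since [z] is captured.
    The map [f] is the identity for the whole space and [inr] for the growth. *)
Lemma tower_ultra_limit : (exists s, F [set t | f t = inl s]) \/
  exists g, forall j, F [set t | tower_test (f t) j = point_test g j].
Proof.
have [/F_word|nword] := pselect (exists i, F (undef i)); [by left|right].
have [|z hz] := @choice _ _ (fun i c =>
  (c < base i)%N /\ F [set t | coord (f t) i = Some c]).
  move=> i.
  have [|c ci Fc] := @F_coord i; last by exists c.
  by move=> Fi; apply: nword; exists i.
have zb i : (z i < base i)%N by have [] := hz i.
have Favoid a n : F [set t | avoids_from a n (f t)] -> forall i,
  (n <= i)%N -> ~~ S a i (z i).
  move=> Fan i ni; have [t [[_ h1] h2]] := filter_ex (filterI Fan (hz i).2).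
  exact: h1 h2.
pose C := [set a | ~ exists n, F [set t | avoids_from a n (f t)]].
have [|g Cg gmin] := @strict_well_order_min L lt C wo.
  have [a na] := capture zb; exists a => -[n Fan]; apply: na.
  by exists n; exact: Favoid.
have zg a : lt a g -> exists n, F [set t | avoids_from a n (f t)].
  by move=> ag; apply: contrapT => na; exact: gmin ag.
have adm : (forall i, (z i < base i)%N) /\ forall a,
  lt a g -> eventually_avoids (S a) z.
  by split=> // a /zg[n Fan]; exists n; exact: Favoid.
exists (exist _ (z, g) adm) => -[[i c]|[a n]] /=.
  by apply: filterS (hz i).2 => t /= e; rewrite /point_test/= e.
have [[ag nz]|h] := pselect (lt a g /\ forall i, (n <= i)%N -> ~~ S a i (z i)).
  have [m Fm] := zg a ag.
  apply: filterS2 Fm (F_forall (n := m) (fun i _ => (hz i).2)) => t [bt h1] h2.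
  transitivity true; last by apply/esym/asboolP; split=> // i c ni [<-]; exact: nz.
  apply/asboolP; split=> // i c ni ti; have [im|mi] := ltnP i m; last exact: h1 ti.
  by move: ti; rewrite h2// => -[<-]; exact: nz.
have pF : `[< avoids_from a n (inr (exist _ (z, g) adm)) >] = false.
  by apply/asboolPn => -[ag h1]; apply: h; split=> // i ni; exact: h1.
suff nF : ~ F [set t | avoids_from a n (f t)].
  by apply: filterS (Fcut nF) => t nt; rewrite /point_test /= pF; apply/asboolPn.
move=> Fan; apply: Cg.
have nz := Favoid _ _ Fan.
(* For a level [a] above [g], an avoidance set of [a] in [F] would give one of [g], because [S g] is
   almost contained in [S a]. *)
have [ag|[ag|ga]] := lt_tri a g; [by exfalso; apply: h|by exists n; rewrite -ag|].
have [k hk] := mono ga; exists (maxn n k).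
apply: filterS Fan => t [bt h1]; split.
  by case: (f t) bt => //= q; exact: lt_tr.
move=> i c; rewrite geq_max => /andP[ni ki] ti.
apply: contra (h1 _ _ ni ti); apply: hk => //; exact: coord_lt ti.
Qed.

End Ultra.

Local Notation K := (test_space tower_test).
Local Notation G := (test_space point_test).

Lemma tower_compact : compact [set: K].
Proof.
rewrite compact_ultra => F UF _; have [[s Fs]|[g Fg]] := tower_ultra_limit id UF.
  exists (inl s); split=> //; apply: cvg_test => j.
  by apply: filterS Fs => t /= ->.
by exists (inr g); split=> //; exact: cvg_test.
Qed.

Lemma tower_hausdorff : hausdorff_space K.
Proof. exact/hausdorff_test/tower_test_inj. Qed.

(** Finitely many tests isolate a word: its digits, and the absence of each of the [base n] possible
    digits at the position where it ends. *)
Lemma agree_inl s : exists js, forall q, agree tower_test js (inl s) q -> q = inl s.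
Proof.
pose n := size (val s).
exists ([seq inl (i, nth 0%N (val s) i) | i <- iota 0 n] ++ [seq inl (n,
  c) | c <- iota 0 (base n)]).
move=> q; rewrite /agree all_cat !all_map => /andP[/allP h1 /allP h2].
have qn : coord q n = None.
  case e: (coord q n) => [c|//]; have := h2 c;
    rewrite mem_iota (coord_lt e) => /(_ isT)/=.
  by rewrite e ltnn eqxx.
have qi i : (i < n)%N -> coord q i = Some (nth 0%N (val s) i).
  move=> ni; have := h1 i; rewrite mem_iota add0n => /(_ ni)/=; rewrite ni eqxx.
  by move=> /eqP/eqP.
case: q qn qi {h1 h2} => [t|//] /=; case: ifPn => // tn _ h.
congr inl; apply/val_inj.
have e : size (val t) = n.
  apply/eqP; rewrite eqn_leq leqNgt tn/= leqNgt; apply/negP => h'.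
  by have := h _ h'; rewrite ltnn.
apply: (@eq_from_nth _ 0%N) => // i; rewrite e => ni.
by have := h i ni; rewrite e ni => -[].
Qed.

Lemma growth_compact : compact [set: G].
Proof.
rewrite compact_ultra => F UF _; have [[s Fs]|[g Fg]] := tower_ultra_limit inr UF.
  by have [] := filter_ex Fs.
by exists g; split=> //; exact: cvg_test.
Qed.

Lemma word_of (f : nat -> nat) n : (forall i, (i < n)%N -> (f i < base i)%N) ->
  exists s : word, size (val s) = n /\ forall i, (i < n)%N -> nth 0%N (val s) i = f i.
Proof.
move=> fb; have [w [wn wf]] : exists w, size w = n /\ forall i,
  (i < n)%N -> nth 0%N w i = f i.
  by exists (mkseq f n); split=> [|i ni]; rewrite ?size_mkseq ?nth_mkseq.
have vs : all (fun i => nth 0 w i < base i)%N (iota 0 (size w)).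
  by apply/allP => i; rewrite mem_iota wn add0n => ni; rewrite wf// fb.
by exists (exist _ w vs).
Qed.

Lemma word_enumeration : exists2 e : nat -> word, injective e & forall s, exists n,
  e n = s.
Proof.
have [w hw] : exists w : nat -> word, forall n, size (val (w n)) = n.
  have [|w hw] := @choice _ _ (fun n (s : word) => size (val s) = n);
    last by exists w.
  by move=> n; have [|s []] := @word_of (fun=> 0%N) n; [move=> *;
    exact: base_gt0|exists s].
have winj : injective w by move=> m n e; rewrite -(hw m) e hw.
have : ([set: word] #= [set: nat])%card.
  apply/card_eqPle; split; first exact: countableP.
  have /card_esym/card_eqPle[h _] : (range w #= [set: nat])%card.
    by apply: inj_card_eq => ? ? _ _; exact: winj.
  by apply: card_le_trans h _; exact: subset_card_le.
move=> /card_set_bijP[f [_ finj fsurj]].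
have [|e he] := @choice _ _ (fun n (s : word) => f s = n).
  by move=> n; have [s _ fs] := fsurj n I; exists s.
exists e => [m n emn|s]; first by rewrite -(he m) emn he.
by exists (f s); apply: finj; [exact: in_setT|exact: in_setT|exact: he].
Qed.

Lemma tower_compactification (e : nat -> word) : injective e ->
  (forall s, exists n, e n = s) ->
  compactification_of_omega (fun n => inl (e n) : K).
Proof.
move=> einj esurj; split.
- exact: tower_compact.
- exact: tower_hausdorff.
- by move=> m n [/einj].
- move=> U [[s|g] Up] oU.
    by have [n sn] := esurj s; exists (inl s); split=> //; exists n; rewrite ?sn.
  have [js hjs] := (open_testE U).1 oU _ Up.
  have [k0 hk0] := agree_far g js.
  (* The word follows the point below [k0], takes the digit [y] of its level at [k0] and ends there,
     so it avoids every slalom beyond [k0] vacuously and [agree_far] applies. *)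
  pose c i := if i == k0 then y (sval g).2 k0 else (sval g).1 i.
  have [|s [sn sc]] := @word_of c k0.+1.
    by move=> i _; rewrite /c; case: eqP => [->|_]; [exact: y_lt|exact: (svalP g).1].
  exists (inl s); split; last by have [n en] := esurj s; exists n; rewrite ?en.
  apply: hjs; apply: (hk0 k0) => //=.
  + move=> i ik; have ik1 : (i < k0.+1)%N by rewrite ltnS ltnW.
    by rewrite sn ik1 sc// /c ltn_eqF.
  + by rewrite sn ltnSn sc// /c eqxx.
  + by split=> // i d ki; rewrite /= sn ltnNge ki.
- move=> _ [n _ <-]; split; first by apply/mem_set; exists n.
  have [js hjs] := agree_inl (e n).
  exists [set inl (e n)]; last first.
    by apply/seteqP; split=> [x []//|x ->]; split=> //; exists n.
  by apply/nbhs_testP; exists js.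
Qed.

Lemma tower_growth g0 : growth_of_omega (pointed_test_space point_test g0).
Proof.
have [e einj esurj] := word_enumeration.
exists K, (fun n => inl (e n) : K); split; first exact: tower_compactification.
pose A : set K := ~` range (fun n => inl (e n) : K).
have Ainr g : A (inr g) by move=> [n _].
have Ainl s : ~ A (inl s) by apply; have [n en] := esurj s; exists n; rewrite ?en.
pose f (g : G) : set_type A := exist _ (inr g) (mem_set (Ainr g)).
pose h (x : set_type A) : G := if val x is inr g then g else g0.
exists f, h; split.
- by [].
- move=> x; apply/val_inj; rewrite /f/h/=.
  by case: x => -[s /set_mem/Ainl|g] // gA.
- apply: continuous_comp_initial => g U /nbhs_testP[js hjs].
  by apply/nbhs_testP; exists js => q gq; exact: hjs.
- move=> x U /nbhs_testP[js hjs].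
  have hx : val x = inr (h x) 
    by case: x {hjs} => -[s sA|//]; exfalso; exact: Ainl (set_mem sA).
  have : nbhs (val x : K) [set q : K | agree tower_test js (val x) q].
    by apply/nbhs_testP; exists js.
  move=> nK; have nA : nbhs x [set w : set_type A | agree tower_test js (val x)
    (val w)].
    exact: (@initial_continuous _ _ (set_val : set_type A -> K) x _ nK).
  apply: (@filterS _ (nbhs x) _ _ _ _ nA) => -[w wA] /=.
  rewrite /h/= hx; case: w wA => [s sA|g gA] /= a; last exact: hjs.
  by exfalso; exact: Ainl (set_mem sA).
Qed.

(** * Boxes: local pi-bases, the measure and non-separability *)

Definition box a n (f : nat -> nat) : set G :=
  tests point_test ((inr (a, n), true) :: [seq (inl (i, f i), true) | i <- iota 0 n]).

Lemma boxP a n f g : box a n f g <-> avoids_from a n (inr g) /\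
  forall i, (i < n)%N -> (sval g).1 i = f i.
Proof.
rewrite /box/tests/= all_map; split=> [/andP[/eqP/asboolP h1 /allP h2]|[h1 h2]].
  by split=> // i ni; have := h2 i; rewrite mem_iota => /(_ ni)/eqP/eqP[].
apply/andP; split; first by apply/eqP/asboolP.
by apply/allP => i; rewrite mem_iota => ni; apply/eqP/eqP; congr Some; exact: h2.
Qed.

Lemma clopen_box a n f : clopen (box a n f).
Proof. exact: clopen_tests. Qed.

(** The greatest level over [z] is the least [t] such that [z] meets [S t] infinitely often; by
    monotonicity the slaloms that [z] eventually avoids are those below [t]. *)
Lemma exists_top z : (forall i, (z i < base i)%N) -> exists g : G, (sval g).1 = z /\
  forall a, eventually_avoids (S a) z -> lt a (sval g).2.
Proof.
move=> zb; have [|t tz tmin] := @strict_well_order_min L lt [set a | ~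
  eventually_avoids (S a) z] wo.
  by have [a] := capture zb; exists a.
have adm : (forall i, (z i < base i)%N) /\ forall a,
  lt a t -> eventually_avoids (S a) z.
  by split=> // a at_; apply: contrapT => /tmin.
exists (exist _ (z, t) adm); split=> //= a az.
have [//|[at_|ta]] := lt_tri a t; first by exfalso; apply: tz; rewrite -at_.
by exfalso; apply: tz; exact: almost_sub_avoids zb (mono ta) az.
Qed.

Variable R : realType.
Hypothesis S_summable : forall a, summable_slalom R (S a).
Local Notation lambda := (@lebesgue_measure R).

(** At the top of the fiber the test [(a, n)] depends on digits alone, so tests have Borel preimages
    and Lebesgue measure can be carried over to the growth. *)
Definition top_point (x : R) : G := sval (cid (exists_top (fun i => digit_lt i x))).

Lemma top_pointE x i : (sval (top_point x)).1 i = digit i x.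
Proof. by rewrite /top_point; case: cid => g /= [->]. Qed.

Lemma avoids_top_point x a n : avoids_from a n (inr (top_point x)) <->
  forall i, (n <= i)%N -> ~~ S a i (digit i x).
Proof.
split=> [[_ h] i ni|h].
  by apply: (h i (digit i x) ni); rewrite /= top_pointE.
split; last by move=> i c ni [<-]; rewrite top_pointE; exact: h.
by rewrite /= /top_point; case: cid => g /= [_]; apply; exists n.
Qed.

Lemma box_top_point a n f x : avoiding f n (S a) x -> box a n f (top_point x).
Proof.
move=> [_ h1 h2]; apply/boxP; split; first exact/avoids_top_point.
by move=> i ni; rewrite top_pointE h1.
Qed.

(** [agree_far] puts a box of the level of [g] inside [U]; it never contains [g] itself. The
    position [k] is also taken so large that the rest of the slalom has total width at most one
    half, whence positive measure. *)
Lemma box_far (g : G) (U : set G) : nbhs g U -> exists n f,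
  box (sval g).2 n f `<=` U /\ (0 < lambda (avoiding f n (S (sval g).2)))%E.
Proof.
move=> /nbhs_testP[js hjs].
have [k0 hk0] := agree_far g js.
have half0 : (0 : R) < 2^-1 by rewrite invr_gt0.
have [k1 hk1] := summable_tail (S_summable (sval g).2) half0.
pose k := maxn k0 k1.
pose f i := if i == k then y (sval g).2 k else (sval g).1 i.
exists k.+1, f; split.
  move=> q /boxP[qa qf]; apply: hjs; apply: (hk0 k _ (inr q)) => //.
  - exact: leq_maxl.
  - move=> i ik; have ik1 : (i < k.+1)%N by apply: leq_trans ik _.
    by rewrite /= qf// /f ltn_eqF.
  - by rewrite /= qf// /f eqxx.
apply: lebesgue_avoiding_gt0.
  by move=> i _; rewrite /f; case: eqP => [->|_]; [exact: y_lt|exact: (svalP g).1].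
move=> m; apply: le_trans (hk1 m); have [km|mk] := ltnP k m; last first.
  by rewrite big_geq ?sum_width_ge0// ltnW.
rewrite (@big_cat_nat _ _ _ k.+1 k1)//=; last by rewrite ltnW// ltnS leq_maxr.
by rewrite lerDr sum_width_ge0.
Qed.

Lemma avoiding_neq0 f n a : (0 < lambda (avoiding f n (S a)))%E ->
  box a n f !=set0.
Proof.
move=> h; have [x fx] : (avoiding f n (S a) : set R) !=set0.
  by apply/set0P/negP => /eqP e; move: h; rewrite e measure0 ltxx.
by exists (top_point x); exact: box_top_point.
Qed.

Lemma tower_pi_character : countable_pi_character G.
Proof.
(* With the level fixed, a box depends only on the first [n] values of [f], so finite sequences
   index all boxes; the empty ones are discarded. *)
move=> g; pose bx (t : seq nat) := box (sval g).2 (size t) (nth 0%N t).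
exists [set V | V !=set0 /\ range bx V].
  apply: sub_countable (countableP [set: seq nat]).
  by apply: card_le_trans (card_image_le bx setT); apply: subset_card_le => V [].
split=> [V [V0 [t _ e]]|U /box_far[n [f [fU fpos]]]].
  by split=> //; rewrite -e; have [] := clopen_box (sval g).2 (size t) (nth 0%N t).
have bE : bx (mkseq f n) = box (sval g).2 n f.
  apply/seteqP; split=> q; rewrite /bx => /boxP; rewrite size_mkseq => -[h1 h2];
    apply/boxP; rewrite ?size_mkseq; split=> // i ni.
    by rewrite h2// nth_mkseq.
  by rewrite nth_mkseq// h2.
exists (box (sval g).2 n f) => //; split; first exact: avoiding_neq0.
by exists (mkseq f n).
Qed.

Lemma measurable_digits (D : nat -> pred nat) :
  measurable [set x : R | 0 <= x < 1 /\ forall i, D i (digit i x)].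
Proof.
have -> : [set x : R | 0 <= x < 1 /\ forall i, D i (digit i x)] =
    \bigcap_m digit_cylinder D m.
  apply/seteqP; split=> x; first by move=> [x01 h] m _; split.
  move=> h; split; first by have [] := h 0%N I.
  by move=> i; have [_] := h i.+1 I; apply.
by apply: bigcapT_measurable => m; exact: measurable_digit_cylinder.
Qed.

Local Notation unit := (`[0, 1[%classic : set R).

Lemma measurable_top_point_test j b :
  measurable ([set x | point_test (top_point x) j = b] `&` unit).
Proof.
suff mt : measurable ([set x | point_test (top_point x) j] `&` unit).
  case: b => //.
  have -> : [set x | point_test (top_point x) j = false] `&` unit =
      unit `\` ([set x | point_test (top_point x) j] `&` unit).
    apply/seteqP; split=> x /=.
      by move=> [xj x1]; split=> // -[]; rewrite xj.
    by move=> [x1 nx]; split=> //; apply/negP => xj; apply: nx.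
  by apply: measurableD.
case: j => [[i c]|[a n]].
  have -> : [set x | point_test (top_point x) (inl (i, c))] `&` unit =
      [set x : R | 0 <= x < 1 /\ forall k, (k == i) ==> (digit k x == c)].
    apply/seteqP; split=> x /=; rewrite in_itv/= top_pointE.
      by move=> [/eqP[xc] x1]; split=> // k; apply/implyP => /eqP ->; rewrite xc.
    by move=> [x1 /(_ i)]; rewrite eqxx /= => /eqP ->.
  exact: (measurable_digits (fun k d => (k == i) ==> (d == c))).
have -> : [set x | point_test (top_point x) (inr (a, n))] `&` unit =
    [set x : R | 0 <= x < 1 /\ forall k, (n <= k)%N ==> ~~ S a k (digit k x)].
  apply/seteqP; split=> x /=; rewrite in_itv/=.
    by move=> [/asboolP/avoids_top_point h x1]; split=> // k; apply/implyP; exact: h.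
  move=> [x1 h]; split=> //; apply/asboolP/avoids_top_point => k nk.
  by have := h k; rewrite nk.
exact: (measurable_digits (fun k d => (n <= k)%N ==> ~~ S a k d)).
Qed.

Lemma measurable_top_point_tests l :
  measurable (top_point @^-1` (tests point_test l) `&` unit).
Proof.
elim: l => [|[j b] l IH].
  have -> : top_point @^-1` (tests point_test [::]) = setT by apply/seteqP; split.
  by rewrite setTI.
have -> : top_point @^-1` tests point_test ((j, b) :: l) `&` unit =
    ([set x | point_test (top_point x) j = b] `&` unit) `&`
    (top_point @^-1` tests point_test l `&` unit).
  apply/seteqP; split=> x /=; rewrite /tests/=.
    by move=> [/andP[/eqP h1 h2] x1].
  by move=> [[h1 x1] [h2 _]]; rewrite h1 eqxx.
by apply: measurableI => //; exact: measurable_top_point_test.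
Qed.

(* The preimage under [top_point] of a clopen set is Borel, but that of an open
   set need not be measurable; hence [radon_extension]. *)
Lemma tower_supports_measure (g0 : G) :
  supports_measure R (pointed_test_space point_test g0).
Proof.
set T := pointed_test_space point_test g0.
have mu1 : measurable unit by [].
pose Cl : set (set T) := [set C : set T | clopen C /\ measurable (top_point @^-1` C
  `&` unit)].
pose m (C : set T) := lambda (top_point @^-1` C `&` unit).
have Cl_tests l : Cl (tests point_test l).
  by split; [exact: clopen_tests|exact: measurable_top_point_tests].
have preU (C D : set T) : top_point @^-1` (C `|` D) `&` unit =
    (top_point @^-1` C `&` unit) `|` (top_point @^-1` D `&` unit).
  by rewrite preimage_setU setIUl.
have [||||||||||mu [rmu hmu]] := @radon_extension R T Cl m.
- exact: growth_compact.
- by move=> C [].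
- by split; [exact: clopen0|rewrite preimage_set0 set0I].
- move=> C [cC mC]; split; first by case: cC => ? ?; split;
  [exact: closed_openC|exact: open_closedC].
  have -> : top_point @^-1` (~` C) `&` unit = unit `\` (top_point @^-1` C `&` unit).
    apply/seteqP; split=> x /=; first by move=> [nC x1]; split=> // -[].
    by move=> [x1 nC]; split=> // Cx; apply: nC.
  exact: measurableD.
- move=> C D [cC mC] [cD mD]; split; first exact: clopenU.
  by rewrite preU; exact: measurableU.
- move=> U g oU Ug; have [js hjs] := (open_testE (U : set G)).1 oU g Ug.
  exists (tests point_test [seq (j, point_test g j) | j <- js]);
    first exact: Cl_tests.
  by rewrite -agreeE; split; [exact: agree_refl|exact: hjs].
- by rewrite /m preimage_set0 set0I measure0.
- by move=> C _; exact: measure_ge0.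
- move=> C D [_ mC] [_ mD] CD; rewrite /m preU measureU//.
  by rewrite setIACA -preimage_setI CD preimage_set0 set0I.
- rewrite /m preimage_setT setTI lebesgue_measure_itv/= lte01 oppr0 adde0.
  exact: ltry.
exists mu; split=> // U oU [g Ug].
have [|n [f [fU fpos]]] := @box_far g U; first exact: open_nbhs_nbhs.
apply: (lt_le_trans fpos); apply: (@le_trans _ _ (m (box (sval g).2 n f))).
  have mA : measurable (avoiding f n (S (sval g).2) : set R).
    exact: measurable_avoiding.
  have mB : measurable (top_point @^-1` (box (sval g).2 n f) `&` unit).
    exact: measurable_top_point_tests.
  rewrite /m; apply: le_measure; [exact: (mem_set mA)|exact: (mem_set mB)|].
  move=> x fx; split; first exact: box_top_point.
    by have [] := fx; rewrite /= in_itv.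
apply: le_trans (hmu _ (Cl_tests _)) _.
have mB (B : set (borel_type T)) : @open T B -> measurable B by exact:
  sub_sigma_algebra.
have mbox := mB _ (clopen_box (sval g).2 n f).1.
by apply: le_measure; [exact: (mem_set mbox)|exact: (mem_set (mB U oU))|exact: fU].
Qed.

Hypothesis capture_seq : forall D : nat -> nat -> nat,
  (forall j i, (D j i < base i)%N) ->
  exists a, forall j, ~ eventually_avoids (S a) (D j).

Lemma tower_not_separable (g0 : G) : ~ separable G.
Proof.
move=> [D cD dD].
have [d hd] : exists d : nat -> G, D `<=` range d.
  move/countable_injP : cD => [f finj].
  have [|d hd] := @choice _ _ (fun n (g : G) => forall h, D h -> f h = n -> g = h).
    move=> n; have [[g Dg fg]|ng] := pselect (exists2 g, D g & f g = n); last first.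
      by exists g0 => h Dh fh; exfalso; apply: ng; exists h.
    by exists g => h Dh fh; apply: finj;
      [exact: mem_set|exact: mem_set|rewrite fg fh].
  by exists d => h Dh; exists (f h) => //; exact: hd.
have [a ha] := capture_seq (fun j => (svalP (d j)).1).
have half0 : (0 : R) < 2^-1 by rewrite invr_gt0.
have [k hk] := summable_tail (S_summable a) half0.
pose f (i : nat) := 0%N.
have [|g [ga /hd[j _ gj]]] := dD (box a k f) _ (clopen_box a k f).1.
  by apply: avoiding_neq0; apply: lebesgue_avoiding_gt0 => // i _; exact: base_gt0.
have /boxP[[_ h] _] := ga; apply: (ha j); exists k => i ki.
by apply: (h i _ ki); rewrite gj.
Qed.

Definition digits_of (g : G) : sequence_space R := (sval g).1.

Lemma digits_of_continuous : continuous digits_of.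
Proof.
move=> g U /nbhs_sequence[n hn].
apply/nbhs_testP; exists [seq inl (i, (sval g).1 i) | i <- iota 0 n.+1] => h.
rewrite /agree all_map => /allP gh; apply: hn => k kn.
have := gh k; rewrite mem_iota add0n ltnS => /(_ kn)/=; rewrite eqxx.
by move=> /eqP/eqP[].
Qed.

(** * Fibers over sequences *)

Section Fibers.
Variable z : sequence_space R.
Local Notation Fz := (fiber digits_of z).
Implicit Types u w : Fz.

Definition fiber_level u : L := (sval (val u)).2.

Let fiber_digits u : (sval (val u)).1 = z.
Proof. by have := set_valP u. Qed.

Let fiber_eq u w : fiber_level u = fiber_level w -> u = w.
Proof.
move=> e; apply/val_inj; have := fiber_digits u; have := fiber_digits w.
move: e; rewrite /fiber_level; case: (val u) => -[x a] ha;
  case: (val w) => -[x' b] hb /=.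
by move=> ab xw xu; apply: eq_exist; congr pair => //; rewrite xw xu.
Qed.

Let fiber_nbhsP u (U : set Fz) : nbhs u U <->
  exists js, forall w, agree point_test js (val u) (val w) -> U w.
Proof.
split.
  rewrite nbhsE => -[V [[V' oV' V'E] Vu] VU].
  have V'u : V' (val u) by have := Vu; rewrite -V'E.
  have [js hjs] := (open_testE (V' : set G)).1 oV' (val u) V'u.
  by exists js => w /hjs V'w; apply: VU; rewrite -V'E.
move=> [js hjs].
have nG : nbhs (val u : G) [set g : G | agree point_test js (val u) g].
  by apply/nbhs_testP; exists js.
apply: (@filterS _ (nbhs u) _ _ _ hjs).
exact: (@initial_continuous _ _ (set_val : Fz -> G) u _ nG).
Qed.

(** If [z] avoids the slalom of the level of [u] from [n] on, then among the points over [z] the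
    corresponding test is passed exactly by those of higher level; otherwise there are no higher
    levels over [z]. *)
Let le_level_nbhs u : nbhs u [set w | ~ lt (fiber_level u) (fiber_level w)].
Proof.
have [[n hn]|nz] := pselect (eventually_avoids (S (fiber_level u)) z).
  apply/fiber_nbhsP; exists [:: inr (fiber_level u, n)] => w;
    rewrite /agree/= andbT => /eqP e uw.
  have uF : point_test (val u) (inr (fiber_level u, n)) = false.
    by apply/asboolPn => -[/lt_irr].
  move: (etrans e uF) => /asboolPn; apply; split=> // i c ni [<-];
    rewrite fiber_digits; exact: hn.
apply/fiber_nbhsP; exists [::] => w _ uw; apply: nz; rewrite -(fiber_digits w).
exact: (svalP (val w)).2.
Qed.

Let gt_level_nbhs a u : lt a (fiber_level u) -> nbhs u [set w | lt a (fiber_level w)].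
Proof.
move=> au; have [n hn] := (svalP (val u)).2 a au.
apply/fiber_nbhsP; exists [:: inr (a, n)] => w; rewrite /agree/= andbT => /eqP e.
have uT : point_test (val u) (inr (a, n)) = true.
  by apply/asboolP; split=> // i c ni [<-]; exact: hn.
by move: (etrans e uT) => /asboolP[].
Qed.

(** The levels up to that of [u] form a neighbourhood of [u], so a point of least level in [A] is
    isolated in [A]. *)
Lemma fiber_scattered : scattered Fz.
Proof.
move=> A [u0 Au0].
have [|a [u Au ua] amin] := @strict_well_order_min L lt (fiber_level @` A) wo.
  by exists (fiber_level u0); exists u0.
exists u; split; first exact/mem_set.
exists [set w | ~ lt (fiber_level u) (fiber_level w)]; first exact: le_level_nbhs.
apply/seteqP; split=> [w [uw Aw]|w ->]; last by split=> //; exact: lt_irr.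
apply: fiber_eq; have [wu|[//|/uw //]] := lt_tri (fiber_level w) (fiber_level u).
by exfalso; apply: (amin (fiber_level w)); [exists w|rewrite -ua].
Qed.

Let exists_level a u : lt a (fiber_level u) -> exists w, fiber_level w = a.
Proof.
move=> au; have adm : (forall i, (z i < base i)%N) /\ forall b,
  lt b a -> eventually_avoids (S b) z.
  rewrite -(fiber_digits u); split; first exact: (svalP (val u)).1.
  by move=> b ba; apply: (svalP (val u)).2; exact: lt_tr ba au.
pose g : G := exist _ (z, a) adm.
have gz : g \in digits_of @^-1` [set z] by apply/mem_set.
by exists (exist _ g gz).
Qed.

(** Over a fixed [z] the digit tests are constant, and the test [(a, n)] takes the same value at all
    levels above [a]. Finitely many tests therefore amount to one lower bound, the largest relevant
    [a] below [u]. *)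
Lemma fiber_base u js : exists lo : option Fz,
  (if lo is Some v then lt (fiber_level v) (fiber_level u) else True) /\
  forall w, (if lo is Some v then lt (fiber_level v) (fiber_level w) else True) ->
    ~ lt (fiber_level u) (fiber_level w) -> agree point_test js (val u) (val w).
Proof.
elim: js => [|j js [lo [hlo IH]]]; first by exists None.
have keep : (forall w, ~ lt (fiber_level u) (fiber_level w) -> point_test (val w) j
  = point_test (val u) j) ->
    exists lo : option Fz, (if lo is Some v then lt (fiber_level v) (fiber_level u)
      else True) /\
    forall w, (if lo is Some v then lt (fiber_level v) (fiber_level w) else True) ->
    ~ lt (fiber_level u) (fiber_level w) -> agree point_test (j :: js) (val u) (val
      w).
  by move=> h; exists lo; split=> // w low uw; rewrite agree_cons h// eqxx; exact: IH.
case: j keep => [[i c]|[a n]] keep.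
  by apply: keep => w _; rewrite /point_test/= !fiber_digits.
have [au|nau] := pselect (lt a (fiber_level u)); last first.
  apply: keep => w uw; transitivity false; last by apply/esym/asboolPn => -[].
  apply/asboolPn => -[/= aw _]; apply: nau.
  by have [wu|[<- //|//]] := lt_tri (fiber_level w) (fiber_level u);
    exact: lt_tr aw wu.
have [v va] := exists_level au.
have same w : lt a (fiber_level w) -> point_test (val w) (inr (a,
  n)) = point_test (val u) (inr (a, n)).
  move=> aw; apply/asboolP/asboolP => -[_ h]; split=> // i c ni /=.
    by rewrite fiber_digits -(fiber_digits w); exact: h.
  by rewrite fiber_digits -(fiber_digits u); exact: h.
have [lov|nlov] := pselect (if lo is Some v' then lt a (fiber_level v') else False).
  exists lo; split=> // w low uw; rewrite agree_cons same ?eqxx; first exact: IH.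
  by case: lo lov low {hlo IH keep} => // v' av'; exact: lt_tr.
exists (Some v); rewrite va; split=> // w aw uw; rewrite agree_cons same ?eqxx//.
apply: IH => //; case: lo nlov {hlo keep} => // v' nav'.
by have [//|[<- //|v'a]] := lt_tri a (fiber_level v'); exact: lt_tr v'a aw.
Qed.

Lemma fiber_linearly_orderable : linearly_orderable Fz.
Proof.
apply: (@linearly_orderable_of _ (fun u w =>
  ~~ `[< lt (fiber_level w) (fiber_level u) >])).
- by move=> u; apply/asboolPn; exact: lt_irr.
- move=> u w /andP[/asboolPn wu /asboolPn uw]; apply: fiber_eq.
  by have [|[]] := lt_tri (fiber_level u) (fiber_level w).
- move=> w u v /asboolPn wu /asboolPn vw; apply/asboolPn => vu.
  by have [|[e|wv]] := lt_tri (fiber_level v) (fiber_level w); [|apply: wu;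
    rewrite -e|apply: wu; exact: lt_tr wv vu].
- move=> u w; rewrite -negb_and; apply/andP => -[/asboolP h1 /asboolP h2].
  exact: lt_irr (lt_tr h1 h2).
- move=> a x /negPn/asboolP ax; apply: filterS (gt_level_nbhs ax) => w aw.
  exact/negPn/asboolP.
- move=> b x /negPn/asboolP xb; apply: filterS (le_level_nbhs x) => w xw.
  apply/negPn/asboolP; have [wx|[->//|/xw//]] :=
    lt_tri (fiber_level w) (fiber_level x).
  exact: lt_tr wx xb.
move=> x U /fiber_nbhsP[js hjs].
have [lo [hlo IH]] := fiber_base x js.
have hlo' : if lo is Some a then ~~ ~~ `[< lt (fiber_level a) (fiber_level x) >]
  else true.
  by case: lo hlo {IH} => // a ax; apply/negPn/asboolP.
have [[w0 xw0]|nw] := pselect (exists w, lt (fiber_level x) (fiber_level w));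
  last first.
  exists lo, None; split; [by case: (lo) hlo'|by []|].
  move=> w low _; apply: hjs; apply: IH.
    by case: lo low {hlo hlo'} => // a /negPn/asboolP.
  by move=> xw; apply: nw; exists w.
(* The immediate successor of [x] in the fiber serves as upper endpoint, which turns the levels up
   to [x] into an open ray. *)
have [|a [xa [b ba]] amin] :=
    @strict_well_order_min L lt [set a | lt (fiber_level x) a /\ exists w,
      fiber_level w = a] wo.
  by exists (fiber_level w0); split=> //; exists w0.
exists lo, (Some b); split; [by case: (lo) hlo'|by apply/negPn/asboolP; rewrite ba|].
move=> w low /negPn/asboolP wb; apply: hjs; apply: IH.
  by case: lo low {hlo hlo'} => // c /negPn/asboolP.
by move=> xw; apply: (amin (fiber_level w)); [split=> //; exists w|rewrite -ba].
Qed.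

End Fibers.

Lemma tower_scatteredly_fibered : scatteredly_fibered R G.
Proof.
exists (sequence_space R), digits_of; split; first exact: digits_of_continuous.
exact: fiber_scattered.
Qed.

Lemma tower_linearly_fibered : linearly_fibered R G.
Proof.
exists (sequence_space R), digits_of; split; first exact: digits_of_continuous.
exact: fiber_linearly_orderable.
Qed.

(** * No continuous map onto the Tychonoff cube *)

Section Cube.
Variables (W : Type) (h : G -> tychonoff_cube R W).
Hypothesis W_uncountable : ~ countable [set: W].
Hypothesis h_cont : continuous h.

Let covers (E : set G) (c : set (W * bool)) :=
  forall b, satisfies c b -> exists2 p, E p & h p = boolean_point R b.

(* If the closed set [h @` E] misses some [boolean_point R b], then it misses all
   of them that agree with [b] on a countable set. *)
Let covers_setU (E F : set G) c : closed E -> consistent c -> covers (E `|` F) c ->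
  exists d, [/\ c `<=` d, consistent d & covers E d \/ covers F d].
Proof.
move=> clE [cc [b0 cb0]] cEF.
have [cE|ncE] := pselect (covers E c); first by exists c; split=> //; [split=> //;
  exists b0|left].
have [b cb nb] : exists2 b, satisfies c b & ~ (h @` E) (boolean_point R b).
  apply: contrapT => nb; apply: ncE => b cb; apply: contrapT => np; apply: nb.
  by exists b => // -[p Ep hp]; apply: np; exists p.
have clhE : closed (h @` E).
  apply: compact_closed; first exact: cube_hausdorff.
  apply: continuous_compact; first exact: continuous_subspaceT.
  exact: subclosed_compact clE growth_compact _.
have nU : nbhs (boolean_point R b) (~` (h @` E)).
  by apply: open_nbhs_nbhs; split=> //; exact: closed_openC.
have [d [cd db] hd] := nbhs_boolean_point nU.
exists (c `|` d); split; first by move=> x; left.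
  split; first exact: countable_setU.
  by exists b => w v [/cb|/db].
right=> b' hb'.
have [|p [Ep|Fp] hp] := cEF b'; [by move=> w v ?; apply: hb'; left| |by exists p].
by exfalso; apply: (hd b') => [w v ?|]; [apply: hb'; right|exists p].
Qed.

Let covers_bigU (E : nat -> set G) n c : (forall i, closed (E i)) -> consistent c ->
  covers (\bigcup_(i < n) E i) c ->
  exists d i, [/\ c `<=` d, consistent d & covers (E i) d].
Proof.
move=> clE; elim: n c => [|n IH] c cc cov.
  by have [_ [b cb]] := cc; have [p [i]] := cov b cb.
have [|d [cd dd [dE|dE]]] := @covers_setU (E n) (\bigcup_(i < n) E i) c (clE n) cc.
- move=> b /cov[p [i /= ilt Ep] hp]; exists p => //.
  by move: ilt; rewrite ltnS leq_eqVlt => /orP[/eqP <-|ilt]; [left|right; exists i].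
- by exists d, n.
have [e [i [de ee eE]]] := IH d dd dE.
by exists e, i; split=> //; exact: subset_trans de.
Qed.

Let prefix n (f : nat -> nat) : set G :=
  [set p | forall i, (i < n)%N -> (sval p).1 i = f i].

Let closed_prefix n f : closed (prefix n f).
Proof.
have -> : prefix n f = tests point_test [seq (inl (i, f i), true) | i <- iota 0 n].
  apply/seteqP; split=> p; rewrite /prefix/tests/= all_map.
    by move=> hp; apply/allP => i; rewrite mem_iota => /hp e; rewrite /= e eqxx.
  move=> /allP hp i ni; have := hp i; rewrite mem_iota => /(_ ni)/eqP/eqP.
  by case.
exact: (clopen_tests _ _).2.
Qed.

Let good (s : nat * (nat -> nat) * set (W * bool)) :=
  consistent s.2 /\ covers (prefix s.1.1 s.1.2) s.2.

Let good_next (s : {s | good s}) : exists t : {s | good s},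
  [/\ (sval t).1.1 = (sval s).1.1.+1,
    forall i, (i < (sval s).1.1)%N -> (sval t).1.2 i = (sval s).1.2 i &
    (sval s).2 `<=` (sval t).2].
Proof.
case: s => -[[n f] c] [/= cc cov].
pose fc k i := if i == n then k else f i.
have [|||d [k [cd dd cov']]] := @covers_bigU (fun k => prefix n.+1 (fc k)) (base n) c.
- by move=> k; exact: closed_prefix.
- exact: cc.
- move=> b /cov[p Ep hp]; exists p => //; exists ((sval p).1 n);
  first exact: (svalP p).1.
  move=> i; rewrite ltnS leq_eqVlt /fc => /orP[/eqP ->|ilt]; first by rewrite eqxx.
  by rewrite ltn_eqF// Ep.
have gt : good (n.+1, fc k, d) by split.
by exists (exist _ _ gt) => /=; split=> // i ilt; rewrite /fc ltn_eqF.
Qed.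

Hypothesis h_surj : forall b, exists p, h p = b.

(** Iterating [good_next] fixes every digit. The conditions increase, so contradictory bits would
    already occur at one stage, and their union is countable. A preimage in the fiber is a cluster
    point of preimages with longer and longer prefixes of [z]. *)
Let covers_fiber : exists (z : nat -> nat) c,
  consistent c /\ covers [set p | (sval p).1 = z] c.
Proof.
have g0 : good (0%N, fun=> 0%N, set0).
  split; first by split=> //; exists (fun=> true).
  by move=> b _; have [p hp] := h_surj (boolean_point R b); exists p.
have [nx hnx] := choice good_next.
pose u k := iter k nx (exist _ _ g0).
have un k : (sval (u k)).1.1 = k by elim: k => // k IH; have [-> _ _] := hnx (u k);
  rewrite IH.
pose z i := (sval (u i.+1)).1.2 i.
have uz k i : (i < k)%N -> (sval (u k)).1.2 i = z i.
  elim: k => // k IH; rewrite ltnS leq_eqVlt => /orP[/eqP -> //|ik].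
  by have [_ h2 _] := hnx (u k); rewrite h2 ?un// IH.
have uc k l : (k <= l)%N -> (sval (u k)).2 `<=` (sval (u l)).2.
  move=> kl; rewrite -(subnKC kl); elim: (l - k)%N => [|d IH]; first by rewrite addn0.
  by rewrite addnS; have [_ _ h3] := hnx (u (k + d)%N); apply: subset_trans h3.
pose c := \bigcup_k (sval (u k)).2.
have cons_c : consistent c.
  split.
    by apply: bigcup_countable => // k _; have [[]] := svalP (u k).
  exists (fun w => `[< c (w, true) >]) => w [] cw; first exact/asboolP.
  apply/asboolPn => -[k _ wt]; have [l _ wf] := cw.
  have [[_ [b hb]] _] := svalP (u (maxn k l)).
  have := hb w true (uc _ _ (leq_maxl k l) _ wt).
  by rewrite (hb w false (uc _ _ (leq_maxr k l) _ wf)).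
exists z, c; split=> // b hb.
have [p hp] : exists p : nat -> G, forall k,
  prefix k z (p k) /\ h (p k) = boolean_point R b.
  have [|p hp] := @choice _ _ (fun k (q : G) =>
    prefix k z q /\ h q = boolean_point R b); last by exists p.
  move=> k; have [_ cov] := svalP (u k).
  have [|q Eq hq] := cov b; first by move=> w v cw; apply: hb; exists k.
  exists q; split=> // i ik; rewrite -(uz _ _ ik); apply: Eq.
  by rewrite un.
have [q [_ clq]] : [set: G] `&` cluster (p @ \oo) !=set0.
  by apply: growth_compact; exact: filterT.
exists q.
  apply/funext => i; have := @closed_prefix i.+1 z q; apply => // U nU.
  have [_ [[k ik <-] Uk]] : [set p k | k in [set k | (i.+1 <= k)%N]] `&` U !=set0.
    by apply: clq => //; exists i.+1 => // k /= ik; exists k.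
  by exists (p k); split=> // j ji; have [-> //] := hp k; exact: leq_trans ik.
apply: cube_hausdorff => U V nU nV.
have [_ [[k _ <-] Uk]] : range p `&` (h @^-1` U) !=set0.
  by apply: clq; [exists 0%N => // k _; exists k|exact: h_cont].
by exists (h (p k)); split=> //; have [_ ->] := hp k; exact: nbhs_singleton.
Qed.

Lemma tower_not_onto_cube : False.
Proof.
have [z [c [cc cov]]] := covers_fiber.
have [_ [b0 cb0]] := cc.
have [p0 p0z _] := cov b0 cb0.
have zb i : (z i < base i)%N by rewrite -p0z; exact: (svalP p0).1.
have [top [topz htop]] := exists_top zb.
(* The levels whose closed initial segment of the fiber covers some cylinder; the least of them,
   [t], will be undercut. *)
pose Q := [set a : L | exists c, consistent c /\
  covers [set p | (sval p).1 = z /\ ~ lt a (sval p).2] c].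
have le_top (p : G) : (sval p).1 = z -> ~ lt (sval top).2 (sval p).2.
  move=> pz lp; apply: (lt_irr (a := (sval top).2)); apply: htop.
  by rewrite -pz; exact: (svalP p).2.
have Qtop : Q (sval top).2.
  exists c; split=> // b /cov[p pz hp]; exists p => //; split=> //; exact: le_top.
have [|t [d [dd dcov]] tmin] := @strict_well_order_min L lt Q wo;
  first by exists (sval top).2.
have adm : (forall i, (z i < base i)%N) /\ forall a,
  lt a t -> eventually_avoids (S a) z.
  split=> // a at_; rewrite -topz; apply: (svalP top).2.
  have [tt|[<- //|tt]] := lt_tri t (sval top).2; first exact: lt_tr at_ tt.
  by have := tmin _ Qtop tt.
pose gt : G := exist _ (z, t) adm.
have [cd [b1 db1]] := dd.
(* The condition [d] is countable, so some coordinate [w] is still free. *)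
have [w wd] : exists w, forall v, ~ d (w, v).
  apply: contrapT => nw; apply: W_uncountable.
  apply: sub_countable cd; apply: card_le_trans (card_image_le fst d).
  apply: subset_card_le => w _; apply: contrapT => nd; apply: nw; exists w => v dw.
  by apply: nd; exists (w, v).
(* At most one of the two bits is the coordinate [w] of the image of [gt]; [v] is the other one.
   Prescribing it excludes a whole neighbourhood of [gt]. *)
have [v hv] : exists v : bool, forall b, b w = v -> h gt w <> boolean_point R b w.
  have [e|ne] := pselect (h gt w = boolean_point R (fun=> true) w).
    by exists false => b bw; rewrite e => e'; have := boolean_point_inj e';
      rewrite bw.
  by exists true => b bw e; apply: ne; rewrite e; apply/val_inj; rewrite /= bw.
pose d' := d `|` [set (w, v)].
have cons_d' : consistent d'.
  split; first by apply: countable_setU.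
  exists (fun w' => if pselect (w' = w) is left _ then v else b1 w') =>
    w' v' [dw|[-> ->]].
    by case: pselect => [e|_]; [exfalso; apply: (wd v'); rewrite -e|exact: db1].
  by case: pselect.
have cov' : covers [set p | ((sval p).1 = z /\ ~ lt t (sval p).2) /\
    h p w = boolean_point R (fun=> v) w] d'.
  move=> b hb; have [|p pE hp] := dcov b; first by move=> ? ? ?; apply: hb; left.
  exists p => //; split=> //; rewrite hp; apply/val_inj; rewrite /= (hb w v)//.
  by right.
have nI : nbhs (h gt w) (~` [set boolean_point R (fun=> v) w]).
  apply: open_nbhs_nbhs; split; last exact: hv.
  apply: closed_openC; apply: accessible_closed_set1; apply: hausdorff_accessible.
  by apply: set_type_hausdorff; exact: Rhausdorff.
have nV : nbhs (h gt) [set q : tychonoff_cube R W | q w <> boolean_point R (fun=>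
  v) w].
  exact: (@proj_continuous {classic W} (fun=> set_type (`[0,
    1]%classic : set R)) w (h gt) _ nI).
have nU : nbhs gt [set p : G | h p w <> boolean_point R (fun=> v) w] := h_cont nV.
have [js hjs] := (nbhs_testP _ _).1 nU.
have in_fiber (p : G) : (sval p).1 = z -> p \in digits_of @^-1` [set (z :
  sequence_space R)].
  by move=> pz; apply/mem_set.
pose u : fiber digits_of (z : sequence_space R) := exist _ gt (in_fiber gt erefl).
(* Up to level [t], the points over [z] above [x] lie in the excluded neighbourhood, so the segment
   up to [x] covers the cylinder of [d']. Without a lower bound no point would remain, although [d']
   is consistent. *)
have [[x|] [xt IH]] := fiber_base u js; last first.
  have [b hb] := cons_d'.2; have [p [[pz pt] pw] _] := cov' b hb.
  exact: hjs p (IH (exist _ p (in_fiber p pz)) I pt) pw.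
apply: (tmin (fiber_level x)) xt; exists d'; split=> // b /cov'[p [[pz pt] pw] hp].
exists p => //; split=> // xp.
exact: hjs p (IH (exist _ p (in_fiber p pz)) xp pt) pw.
Qed.

End Cube.

End TowerSpace.

(** * The growth obtained from the equality of the two cardinals *)

Theorem theorem5p4 (R : realType)
    (add_null_eq_non_meager : exists (U : Type) (kappa : set U),
        is_add (null_ideal R) kappa /\ is_non (meager_ideal R) kappa) :
  exists G : ptopologicalType,
    growth_of_omega G
    /\ ~ separable G
    /\ supports_measure R G
    /\ countable_pi_character G
    /\ scatteredly_fibered R G
    /\ linearly_fibered R G
    /\ (forall (W : Type) (le : rel W), is_omega1 le ->
          ~ maps_continuously_onto G (tychonoff_cube R W)).
Proof.
have [U [kappa [[_ add_min] [[Y nY Yk] _]]]] := add_null_eq_non_meager.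
have [L [lt [x [wo seg xY]]]] := initial_well_order Yk.
have dir a (F : L -> nat -> pred nat) :
    (forall b, lt b a -> summable_slalom R (F b)) ->
    exists2 T, summable_slalom R T & forall b, lt b a -> almost_sub (F b) T.
  move=> sF.
  have [|T sT FT] := @localization R {b | lt b a} (fun i => F (sval i)).
    pose A : set (set R) := [set (limsup_digits (F b) : set R) | b in [set b | lt b
      a]].
    suff nA : null_ideal R (\bigcup_(B in A) B).
      apply: negligibleS nA => r [[b ba] _ Fr].
      by exists (limsup_digits (F b) : set R) => //; exists b.
    (* If the union were not null, the initial segment below [a] would index at least add(N) many
       null sets, against the choice of the order. *)
    apply: contrapT => nA; apply: (seg a).
    apply: card_le_trans (card_image_le (fun b => limsup_digits (F b) : set R) _).
    apply: add_min; split=> // _ [b ba <-].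
    exact/limsup_digits_null/sF.
  by exists T => // b ba; exact: (FT (exist _ b ba)).
have [S [y Sy]] := slalom_tower x wo dir.
have S_sum a : summable_slalom R (S a) by have [] := Sy a.
have mono a b : lt b a -> almost_sub (S b) (S a) by have [_ h _ _ _] := Sy a;
  exact: h.
have y_lt a i : (y a i < base i)%N by have [_ _ _ /(_ i)[]] := Sy a.
have y_in a i : S a i (y a i) by have [_ _ _ /(_ i)[]] := Sy a.
have y_out a b : lt b a -> eventually_avoids (S b) (y a).
  by have [_ _ _ _ h] := Sy a; exact: h.
have capture_seq (D : nat -> nat -> nat) : (forall j i, (D j i < base i)%N) ->
    exists a, forall j, ~ eventually_avoids (S a) (D j).
  (* The nonmeager set [Y] is the range of [x], so some [x a] shares infinitely many digits with
     each [D j], and [S a] contains all digits of [x a]. *)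
  move=> /(nonmeager_infinitely_often nY)[r]; rewrite -xY => -[a _ <-] hD.
  exists a => j [k hk]; have [i ki iD] := hD j k.
  have [_ _ /(_ i) + _ _] := Sy a.
  by rewrite iD; apply/negP; exact: hk.
have capture z : (forall i, (z i < base i)%N) -> exists a,
  ~ eventually_avoids (S a) z.
  by move=> zb; have [|a ha] := capture_seq (fun=> z); [|exists a; exact: (ha 0%N)].
pose g0 := top_point wo mono capture (0 : R).
exists (pointed_test_space (@point_test L lt S) g0).
split; first exact: (tower_growth wo mono y_lt y_in y_out capture g0).
split; first exact: (tower_not_separable wo mono capture S_sum capture_seq g0).
split; first exact: (tower_supports_measure wo mono y_lt y_in y_out capture S_sum g0).
split; first exact: (tower_pi_character wo mono y_lt y_in y_out capture S_sum).
split; first exact: (tower_scatteredly_fibered S wo R).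
split; first exact: (tower_linearly_fibered S wo R).
move=> W le [_ W_unc _] [h [h_cont h_surj]].
exact: (tower_not_onto_cube wo mono capture W_unc h_cont h_surj).
Qed.
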